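(* Let $n\ge 2$ and $d\ge 2$ be integers, let $\alpha>0$ be real, and put $\tau=2\pi/n$. Let $$\Lambda=\{x\in H^1_{2\pi}(\mathbb{R},\mathbb{R}^d): x(t)\neq x(t+h\tau)\ \text{for all } t\in\mathbb{R},\ h=1,\dots,n-1\}$$ and, for $x\in\Lambda$, $$\mathcal{A}(x)=\frac12\int_0^{2\pi}|\dot x(t)|^2\,dt+\frac12\sum_{h=1}^{n-1}\int_0^{2\pi}\frac{dt}{|x(t)-x(t+h\tau)|^\alpha}.$$ Then the absolute minimum of $\mathcal{A}$ on $\Lambda$ is attained on a relative equilibrium motion associated to the regular $n$-gon; that is, there exists $\bar x\in\Lambda$ with $\mathcal{A}(\bar x)=\min_{\Lambda}\mathcal{A}$ such that the motion of the $n$ bodies $q_i(t)=\bar x(t+(i-1)\tau)$, $i=1,\dots,n$, is a relative equilibrium motion whose central configuration is a regular $n$-gon.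
   Context: $H^1_{2\pi}(\mathbb{R},\mathbb{R}^d)$ is the space of $2\pi$-periodic functions $\mathbb{R}\to\mathbb{R}^d$ that are locally in the Sobolev class $H^1$. A loop $x\in\Lambda$ represents a simple choreography of $n$ bodies of unit mass, $q_i(t)=x(t+(i-1)\tau)$, $i=1,\dots,n$, attracting each other through the pair potential $-1/|q_i-q_j|^\alpha$. A central configuration is a configuration (with center of mass at the origin) in which the acceleration vector of every particle, given by the attractive forces, is $\ddot q_i=-kq_i$ with a common $k>0$. A relative equilibrium motion is a rigid and uniform rotation of a central configuration around its center of mass. *)

(* Defs.v *)
From mathcomp Require Import all_boot all_order all_algebra.
From mathcomp Require Import all_classical all_reals all_analysis.
Set Implicit Arguments.
Unset Strict Implicit.
Unset Printing Implicit Defensive.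
Import Order.TTheory GRing.Theory Num.Theory.
Import numFieldNormedType.Exports.
Local Open Scope classical_set_scope.
Local Open Scope ring_scope.

(* The norm that MathComp-Analysis puts on 'rV[R]_d is the sup norm, so the
   Euclidean structure of R^d is introduced here. The topology is the same. *)
Definition dotv (R : realType) (d : nat) (u v : 'rV[R]_d) : R :=
  \sum_(i < d) u ord0 i * v ord0 i.

Definition enorm (R : realType) (d : nat) (u : 'rV[R]_d) : R :=
  Num.sqrt (dotv u u).

(* Functions of class L^2_loc on the real line. *)
Definition L2loc (R : realType) (f : R -> R) : Prop :=
  measurable_fun [set: R] f /\
  locally_integrable [set: R] (fun t => f t ^+ 2).

(* Test functions: class C^1 with compact support. In dimension one this class
   is the usual choice (Brezis, Functional Analysis, Sobolev Spaces and PDE,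
   Section 8.2); it yields the same weak derivatives as C^oo_c. *)
Definition test_function (R : realType) (phi : R -> R) : Prop :=
  [/\ forall t, derivable phi t 1, continuous (derive1 phi)
    & exists M : R, forall t, M < `|t| -> phi t = 0].

Definition is_weak_derivative (R : realType) (d : nat) (x v : R -> 'rV[R]_d) :
    Prop :=
  forall i : 'I_d, L2loc (fun t => v t ord0 i) /\
    forall phi : R -> R, test_function phi ->
      (\int[lebesgue_measure]_(t in [set: R]) (x t ord0 i * derive1 phi t) =
       - \int[lebesgue_measure]_(t in [set: R]) (v t ord0 i * phi t))%R.

(* H^1_{2 pi}(R, R^d). An element of H^1_loc is a class modulo null sets which
   contains exactly one continuous function; the class is represented here by
   that function, so that pointwise conditions on x make sense. *)
Definition H1_2pi (R : realType) (d : nat) : set (R -> 'rV[R]_d) :=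
  [set x : R -> 'rV[R]_d | [/\ continuous x, periodic x (2 * pi),
    forall i : 'I_d, L2loc (fun t => x t ord0 i)
    & exists v, is_weak_derivative x v]].

(* A representative of the weak derivative, which is unique almost
   everywhere; only meaningful when a weak derivative exists. *)
Definition weak_deriv (R : realType) (d : nat) (x : R -> 'rV[R]_d) :
    R -> 'rV[R]_d :=
  get [set v | is_weak_derivative x v].

Definition tau (R : realType) (n : nat) : R := 2 * pi / n%:R.

Definition Lambda (R : realType) (n d : nat) : set (R -> 'rV[R]_d) :=
  [set x : R -> 'rV[R]_d | H1_2pi x /\
    forall (t : R) (h : nat), (1 <= h <= n.-1)%N ->
      x t <> x (t + h%:R * tau R n)].

(* The values are extended reals, so no integrability is presupposed; the
   action is finite on Lambda. *)
Definition action (R : realType) (n d : nat) (alpha : R)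
    (x : R -> 'rV[R]_d) : \bar R :=
  ((2^-1)%:E *
     \int[lebesgue_measure]_(t in `[0%R, (2 * pi)%R])
        ((enorm (weak_deriv x t)) ^+ 2)%:E +
   (2^-1)%:E * \sum_(1 <= h < n)
     \int[lebesgue_measure]_(t in `[0%R, (2 * pi)%R])
        ((enorm (x t - x (t + h%:R * tau R n))) `^ alpha)^-1%:E)%E.

(* The bodies are numbered from 0: body i follows x (t + i tau). *)
Definition choreography (R : realType) (n d : nat) (x : R -> 'rV[R]_d) :
    'I_n -> R -> 'rV[R]_d :=
  fun i t => x (t + (i : nat)%:R * tau R n).
Arguments choreography {R} n {d} x.

(* Total force on body i (unit masses): minus the gradient with respect to q_i
   of the potential energy - \sum_(i < j) 1 / |q_i - q_j| ^ alpha. *)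
Definition attraction (R : realType) (n d : nat) (alpha : R)
    (q : 'I_n -> 'rV[R]_d) (i : 'I_n) : 'rV[R]_d :=
  \sum_(j < n | j != i)
    (- (alpha / enorm (q i - q j) `^ (alpha + 2))) *: (q i - q j).

Definition central_configuration (R : realType) (n d : nat) (alpha : R)
    (c : 'I_n -> 'rV[R]_d) : Prop :=
  [/\ injective c, \sum_(i < n) c i = 0
    & exists2 k : R, 0 < k & forall i, attraction alpha c i = - (k *: c i)].

(* The equations of motion q_i'' = (total force on body i). *)
Definition newton_solution (R : realType) (n d : nat) (alpha : R)
    (q : 'I_n -> R -> 'rV[R]_d) : Prop :=
  forall (i : 'I_n) (t : R),
    [/\ derivable (q i) t 1, derivable (derive1 (q i)) t 1
      & derive1n 2 (q i) t = attraction alpha (fun j => q j t) i].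

(* Uniform rotations about the origin: continuous one-parameter groups in
   SO(d), acting on row vectors by right multiplication. *)
Definition uniform_rotation (R : realType) (d : nat) (Q : R -> 'M[R]_d) :
    Prop :=
  [/\ forall t, Q t *m (Q t)^T = 1%:M /\ \det (Q t) = 1,
      forall s t, Q (s + t) = Q s *m Q t
    & continuous Q].

(* q is a motion of the n bodies obtained by rotating rigidly and uniformly the
   central configuration c about its center of mass (the origin). The equations
   of motion force the squared angular velocity to be the k of c. *)
Definition relative_equilibrium (R : realType) (n d : nat) (alpha : R)
    (c : 'I_n -> 'rV[R]_d) (q : 'I_n -> R -> 'rV[R]_d) : Prop :=
  [/\ central_configuration alpha c,
      exists2 Q : R -> 'M[R]_d, uniform_rotation Q
        & forall i t, q i t = c i *m Q t
    & newton_solution alpha q].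

(* Consecutive vertices of a regular n-gon with center p and circumradius r, in
   the plane through p spanned by the orthonormal vectors u and w. *)
Definition regular_ngon (R : realType) (n d : nat) (c : 'I_n -> 'rV[R]_d) :
    Prop :=
  exists (p u w : 'rV[R]_d) (r : R),
    [/\ 0 < r, dotv u u = 1, dotv w w = 1, dotv u w = 0
      & forall i : 'I_n,
          c i = p + (r * cos ((i : nat)%:R * tau R n)) *: u
                  + (r * sin ((i : nat)%:R * tau R n)) *: w].

(* Main.v *)
Require Import Defs.
From mathcomp Require Import all_boot all_order all_algebra.
From mathcomp Require Import all_classical all_reals all_analysis.
From mathcomp Require Import measurable_realfun.
From mathcomp Require Import zify ring lra.
Import Order.TTheory GRing.Theory Num.Theory.
Import numFieldNormedType.Exports.
Local Open Scope classical_set_scope.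
Local Open Scope ring_scope.

(** Let K be the integral of |x'|^2 over a period and s = h tau. The k-th
    Fourier coefficient of x(t + s) - x(t) is that of x multiplied by
    e^(iks) - 1, of modulus 2 |sin (k s / 2)| <= 2 |k| |sin (s / 2)|. Hence the
    integral of |x(t + s) - x(t)|^2 is at most 4 sin^2 (s / 2) K, with equality
    when x is a uniform circular motion of period 2 pi (lemma [chord_le]).

    The function q |-> q^(-alpha/2) is convex, so it lies above its tangent at
    the squared chord q_h = (2 r sin (h pi / n))^2 of the circle of radius r.
    Taking this tangent in each potential term and then using the chord
    inequality bounds the action from below by an affine function of K. For the
    radius r solving the balance equation of [balanced_radius], the coefficient
    of K vanishes ([action_lower_bound]) and the constant that remains is the
    action of the circle itself ([circle_action]). The same balance equation says
    that the attraction on a vertex of the n-gon of radius r is the centripetal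
    acceleration of a rotation with angular velocity 1 ([circle_attraction]), so
    the circular motion solves the equations of motion.

    The chord inequality is proved with the finite Fourier transform only. The
    loop is sampled with a step delta = 2 pi / N, N a multiple of n. On Z/N the
    inequality compares the chords over m steps with the sides of the sampled
    polygon ([discrete_chord]); mode by mode it is the trigonometric inequality
    |sin (k m theta)| sin theta <= sin (m theta) sin (k theta), theta = pi / N
    ([dirichlet_half]). The sides are controlled by K ([polygon_energy]);
    integrating over the starting point of the sampling and letting N tend to
    infinity gives the result.

    Weak derivatives enter through one formula, x(b) - x(a) is the integral of v
    over [a, b] ([weak_ftc]), obtained from C^1 test functions that approximate
    the indicator of [a, b]. It gives the Cauchy-Schwarz bound behind
    [polygon_energy]. It also identifies every weak derivative of the circular
    motion almost everywhere, which is what computing its action requires, since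
    the action is defined with an arbitrary choice of the weak derivative. *)

Set Implicit Arguments.
Unset Strict Implicit.
Unset Printing Implicit Defensive.

(** * Trigonometric inequalities *)

Section Trig.
Variable R : realType.
Implicit Types (a b : R) (k m N : nat).

Lemma cos_1B2sin2 a : cos a = 1 - 2 * sin (a / 2) ^+ 2.
Proof.
have e : a = (a / 2) *+ 2 by rewrite mulr2n; field.
by rewrite [in LHS]e cos_mulr2n sin2cos2 -mulr_natl; ring.
Qed.

Lemma sin_le_id a : 0 < a -> sin a <= a.
Proof.
move=> a0; have ds (x : R) : is_derive x 1 sin (cos x) by exact: is_derive_sin.
have cs : {within `[0, a], continuous (@sin R)}.
  exact/continuous_subspaceT/continuous_sin.
have [c _] := @MVT R sin cos 0 a a0 (fun x _ => ds x) cs.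
rewrite sin0 !subr0 => ->.
by rewrite -[leRHS]mul1r ler_wpM2r ?cos_le1 // ltW.
Qed.

(** Concavity of the sine: by the mean value theorem its mean slope on [0, a] is
    at least the one on [a, pi / 2], so the graph lies above the chord joining
    the two ends of [0, pi / 2]. *)
Lemma jordan_sin a : 0 <= a <= pi / 2 -> 2 * a / pi <= sin a.
Proof.
move=> /andP[a0 a1]; have pi0 := pi_gt0 R.
have [->|an0] := eqVneq a 0; first by rewrite mulr0 mul0r sin0.
have [->|an1] := eqVneq a (pi / 2).
  by rewrite sin_pihalf mulrCA mulfV// mulr1 divff// gt_eqF.
have {}a0 : 0 < a by rewrite lt_neqAle eq_sym an0.
have {}a1 : a < pi / 2 by rewrite lt_neqAle an1.
have ds (x : R) : is_derive x 1 sin (cos x) by exact: is_derive_sin.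
have cs A : {within A, continuous (@sin R)}.
  exact/continuous_subspaceT/continuous_sin.
have [xi] := @MVT R sin cos 0 a a0 (fun x _ => ds x) (cs _).
rewrite in_itv/= => /andP[xi0 xi1]; rewrite sin0 !subr0 => sa.
have [eta] := @MVT R sin cos a (pi / 2) a1 (fun x _ => ds x) (cs _).
rewrite in_itv/= => /andP[e0 e1]; rewrite sin_pihalf => s1.
have ce : cos eta <= cos xi.
  by rewrite ltW// ltr_cos ?in_itv/= //; [lra|apply/andP; split; lra|
    apply/andP; split; lra].
have key : a * (1 - sin a) <= (pi / 2 - a) * sin a.
  rewrite s1 sa.
  have : 0 <= (pi / 2 - a) * a * (cos xi - cos eta).
    by rewrite !mulr_ge0 ?subr_ge0// ltW.
  lra.
rewrite ler_pdivrMr//; lra.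
Qed.

(** The quotient sin (k x) / sin x decreases for x between 0 and pi / k. By the
    addition formula, its value for k + 1 is cos x times its value for k, plus
    cos (k x), and all these terms decrease. *)
Lemma sin_mul_le k (theta beta : R) : 0 < theta -> theta <= beta ->
  k%:R * beta <= pi -> sin (k%:R * beta) * sin theta <= sin beta * sin (k%:R * theta).
Proof.
move=> t0 tb; have b0 : 0 < beta by lra.
elim: k => [|k IH] kb; first by rewrite !mul0r sin0 mul0r mulr0.
have [->|k0] := posnP k; first by rewrite !mul1r.
have k1 : 1 <= k%:R :> R by rewrite ler1n.
move: kb; rewrite -natr1 => kb.
have kbb : k%:R * beta <= pi - beta by lra.
have b1 : beta <= k%:R * beta by rewrite ler_peMl// ltW.
have kt : k%:R * theta <= k%:R * beta by rewrite ler_wpM2l.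
have kt0 : 0 < k%:R * theta by rewrite mulr_gt0//; lra.
have {}IH := IH ltac:(lra).
rewrite !mulrDl !mul1r !sinD.
have st : 0 <= sin theta by apply: sin_ge0_pi; apply/andP; split; lra.
have sb : 0 <= sin beta by apply: sin_ge0_pi; apply/andP; split; lra.
have skb : 0 <= sin (k%:R * beta) by apply: sin_ge0_pi; apply/andP; split; lra.
have cle u v : 0 <= u -> u <= v -> v <= pi -> cos v <= cos u.
  move=> u0 uv v1; have [->//|uv'] := eqVneq u v.
  by rewrite ltW// ltr_cos ?in_itv/= ?lt_neqAle ?uv' ?uv//; apply/andP; split; lra.
have c1 : cos beta <= cos theta by apply: cle; lra.
have c2 : cos (k%:R * beta) <= cos (k%:R * theta) by apply: cle; lra.
have ct : 0 <= cos theta by apply: cos_ge0_pihalf; apply/andP; split; lra.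
have h1 : 0 <= sin (k%:R * beta) * sin theta * (cos theta - cos beta).
  by rewrite !mulr_ge0// subr_ge0.
have h2 : 0 <= sin beta * sin theta * (cos (k%:R * theta) - cos (k%:R * beta)).
  by rewrite !mulr_ge0// subr_ge0.
have h3 : 0 <= cos theta * (sin beta * sin (k%:R * theta) - sin (k%:R * beta) * sin theta).
  by rewrite !mulr_ge0// subr_ge0.
lra.
Qed.

(** As long as the angle k m pi / N does not exceed pi this is the monotonicity
    of sin (k x) / sin x. Beyond, the left-hand side is at most theta = pi / N,
    while Jordan's inequality bounds the right-hand side from below by
    4 k m theta^2 / pi^2, which is at least 4 theta / pi. *)
Lemma dirichlet_half k m N : (0 < k)%N -> (0 < m)%N -> (2 * k <= N)%N ->
  (2 * m <= N)%N ->
  `|sin (k%:R * (m%:R * (pi / N%:R)))| * sin (pi / N%:R) <=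
   sin (m%:R * (pi / N%:R)) * sin (k%:R * (pi / N%:R)) :> R.
Proof.
move=> k0 m0 kN mN; have pi0 := pi_gt0 R.
have N0 : 0 < N%:R :> R by rewrite ltr0n; lia.
set theta := pi / N%:R; have t0 : 0 < theta by rewrite divr_gt0.
have Nt : N%:R * theta = pi by rewrite /theta; field; rewrite gt_eqF.
have half j : (2 * j <= N)%N -> j%:R * theta <= pi / 2.
  move=> jN; rewrite ler_pdivlMr// mulrAC -Nt ler_wpM2r ?(ltW t0)//.
  by rewrite -natrM ler_nat mulnC.
have k1 : 1 <= k%:R :> R by rewrite ler1n.
have m1 : 1 <= m%:R :> R by rewrite ler1n.
have tm : theta <= m%:R * theta by rewrite ler_peMl// ltW.
have tk : theta <= k%:R * theta by rewrite ler_peMl// ltW.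
have hm := half _ mN; have hk := half _ kN.
have [le_pi|gt_pi] := leP (k%:R * (m%:R * theta)) pi.
  have kmt : 0 <= k%:R * (m%:R * theta) by rewrite !mulr_ge0// ltW.
  rewrite ger0_norm; last by apply: sin_ge0_pi; rewrite kmt.
  exact: sin_mul_le.
apply: (@le_trans _ _ theta).
  rewrite -[leRHS]mul1r ler_pM ?sin_max ?sin_le_id//.
  by apply: sin_ge0_pi; apply/andP; split; lra.
apply: (@le_trans _ _ ((2 * (m%:R * theta) / pi) * (2 * (k%:R * theta) / pi))); last first.
  by rewrite ler_pM ?jordan_sin ?divr_ge0 ?mulr_ge0// ?(ltW t0) ?(ltW pi0)//;
    apply/andP; split; lra.
rewrite mulf_div ler_pdivlMr ?mulr_gt0//.
have : pi < 4 :> R by have := pihalf_lt2 R; lra.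
move=> p4; have := ler_pM2r t0 pi (k%:R * (m%:R * theta)).
nra.
Qed.

Lemma norm_sinDpin (a : R) j : `|sin (a + pi *+ j)| = `|sin a|.
Proof.
elim: j => [|j IH]; first by rewrite mulr0n addr0.
by rewrite mulrSr addrA sinDpi normrN.
Qed.

Lemma norm_sin_natB (j k N : nat) : (0 < N)%N -> (k <= N)%N ->
  `|sin (j%:R * ((N - k)%:R * (pi / N%:R)))| =
  `|sin (j%:R * (k%:R * (pi / N%:R)))| :> R.
Proof.
move=> N0 kN.
have -> : j%:R * ((N - k)%:R * (pi / N%:R)) =
    - (j%:R * (k%:R * (pi / N%:R))) + pi *+ j :> R.
  rewrite natrB// -[pi *+ j]mulr_natl; field.
  by rewrite pnatr_eq0 -lt0n.
by rewrite norm_sinDpin sinN normrN.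
Qed.

(** The reflections m |-> N - m and k |-> N - k only change signs, so both
    indices can be taken at most N / 2. *)
Lemma dirichlet_le k m N : (0 < k < N)%N -> (0 < m < N)%N ->
  `|sin (k%:R * (m%:R * (pi / N%:R)))| * `|sin (pi / N%:R)| <=
   `|sin (m%:R * (pi / N%:R))| * `|sin (k%:R * (pi / N%:R))| :> R.
Proof.
wlog mN : m / (2 * m <= N)%N.
  move=> H kN mN; have [|h] := leqP (2 * m) N; first by move/H; apply.
  have N0 : (0 < N)%N by lia.
  have /H/(_ kN) : (2 * (N - m) <= N)%N by lia.
  have mN' : (m <= N)%N by lia.
  rewrite norm_sin_natB//; have := norm_sin_natB 1 N0 mN'; rewrite !mul1r => ->.
  by apply; lia.
wlog kN : k / (2 * k <= N)%N.
  move=> H kN mN0; have [|h] := leqP (2 * k) N; first by move/H; apply.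
  have N0 : (0 < N)%N by lia.
  have /H : (2 * (N - k) <= N)%N by lia.
  have kN' : (k <= N)%N by lia.
  rewrite mulrCA norm_sin_natB//; have := norm_sin_natB 1 N0 kN'; rewrite !mul1r => ->.
  by rewrite mulrCA; apply => //; lia.
move=> k0 m0; have pi0 := pi_gt0 R.
have N0 : 0 < N%:R :> R by rewrite ltr0n; lia.
have sge j : (2 * j <= N)%N -> 0 <= sin (j%:R * (pi / N%:R)) :> R.
  move=> jN; apply: sin_ge0_pi; rewrite !mulr_ge0 ?invr_ge0 ?(ltW pi0) ?(ltW N0)//=.
  rewrite mulrA ler_pdivrMr// mulrC ler_wpM2l ?(ltW pi0)// ler_nat; lia.
rewrite (ger0_norm (sge _ mN)) (ger0_norm (sge _ kN)).
have := sge 1; rewrite !mul1r => s1; rewrite (ger0_norm (s1 _)); last by lia.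
by apply: dirichlet_half => //; lia.
Qed.

(** The shift by m steps minus the identity multiplies the k-th Fourier mode on
    Z/N by a factor of squared modulus 2 (1 - cos (2 pi k m / N)). Relative to
    the same factor for m = 1, it is largest for k = 1 among the modes k <> 0. *)
Lemma chord_kernel k m N : (k < N)%N -> (0 < m < N)%N ->
  (1 - cos (m%:R * (k%:R * (2 * pi / N%:R)))) * sin (pi / N%:R) ^+ 2 <=
  (1 - cos (k%:R * (2 * pi / N%:R))) * sin (m%:R * (pi / N%:R)) ^+ 2 :> R.
Proof.
move=> kN mN.
have [->|k0] := posnP k; first by rewrite !mul0r mulr0 cos0 subrr !mul0r.
have := @dirichlet_le k m N; rewrite k0 kN => /(_ isT mN).
have e a : 1 - cos (2 * a) = 2 * sin a ^+ 2 :> R.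
  by rewrite cos_1B2sin2 (_ : 2 * a / 2 = a); [ring|field].
rewrite -[2 * pi / _]mulrA; set u := pi / N%:R.
rewrite (_ : m%:R * (k%:R * (2 * u)) = 2 * (k%:R * (m%:R * u))); last by ring.
rewrite (_ : k%:R * (2 * u) = 2 * (k%:R * u)); last by ring.
rewrite !e.
move=> h; rewrite -[leLHS]mulrA -[leRHS]mulrA ler_pM2l ?ltr0n// -!exprMn.
rewrite -[leLHS]real_normK ?num_real// -[leRHS]real_normK ?num_real//.
rewrite ler_sqr ?nnegrE// !normrM; move: h; lra.
Qed.

(** The vector formed by the two sums is invariant under the rotation by a. *)
Lemma trig_sum0 N (a : R) : cos (N%:R * a) = 1 -> sin (N%:R * a) = 0 ->
  cos a != 1 -> \sum_(k < N) cos (k%:R * a) = 0 /\ \sum_(k < N) sin (k%:R * a) = 0.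
Proof.
move=> cN sN c1; set C := \sum_(k < N) _; set S := \sum_(k < N) _.
have shift (f : R -> R) : f (N%:R * a) = f 0 ->
    \sum_(k < N) f (k%:R * a + a) = \sum_(k < N) f (k%:R * a).
  move=> fN; apply: (addrI (f 0)).
  transitivity (\sum_(k < N.+1) f (k%:R * a)).
    rewrite big_ord_recl mul0r; congr (_ + _); apply: eq_bigr => k _.
    by rewrite lift0 -natr1 mulrDl mul1r.
  by rewrite big_ord_recr/= fN addrC.
have hC : C * cos a - S * sin a = C.
  rewrite -[RHS](shift cos) ?cos0// !mulr_suml -sumrB.
  by apply: eq_bigr => k _; rewrite cosD.
have hS : S * cos a + C * sin a = S.
  rewrite -[RHS](shift sin) ?sin0// !mulr_suml -big_split/=.
  by apply: eq_bigr => k _; rewrite sinD.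
have cs := cos2Dsin2 a.
have D0 : 1 - cos a != 0 by rewrite subr_eq0 eq_sym.
split; apply: (mulfI D0); rewrite mulr0.
- have -> : (1 - cos a) * C = ((1 - cos a) * (C - (C * cos a - S * sin a)) -
    sin a * (S - (S * cos a + C * sin a)) +
    C * (1 - (cos a ^+ 2 + sin a ^+ 2))) / 2 by field.
  by rewrite hC hS cs !subrr !mulr0 subr0 addr0 mul0r.
- have -> : (1 - cos a) * S = ((1 - cos a) * (S - (S * cos a + C * sin a)) +
    sin a * (C - (C * cos a - S * sin a)) +
    S * (1 - (cos a ^+ 2 + sin a ^+ 2))) / 2 by field.
  by rewrite hC hS cs !subrr !mulr0 !addr0 mul0r.
Qed.
End Trig.

(** * Finite Fourier analysis *)

Section DFT.
Variable R : realType.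
Variable N : nat.
Hypothesis N0 : (0 < N)%N.
Implicit Types (y z : nat -> R).
Let delta : R := 2 * pi / N%:R.

(** The real part and, up to sign, the imaginary part of the k-th Fourier
    coefficient on Z/N. *)
Definition dft_cos z k := \sum_(j < N) z j * cos (j%:R * (k%:R * delta)).
Definition dft_sin z k := \sum_(j < N) z j * sin (j%:R * (k%:R * delta)).

Lemma sum_periodic_shift z m : (forall j, z (j + N)%N = z j) ->
  \sum_(j < N) z (j + m)%N = \sum_(j < N) z j.
Proof.
move=> zN; elim: m => [|m IH]; first by apply: eq_bigr => j _; rewrite addn0.
rewrite -IH; apply: (addrI (z m)).
transitivity (\sum_(j < N.+1) z (j + m)%N).
  by rewrite big_ord_recl; congr (_ + _); apply: eq_bigr => j _; rewrite lift0 addnS.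
by rewrite big_ord_recr/= addrC addnC zN.
Qed.

Lemma cos_freq_neq1 (a : R) : 0 < `|a| < 2 * pi -> cos a != 1.
Proof.
rewrite -cos_norm => /andP[a0 a1]; rewrite cos_1B2sin2.
have : 0 < sin (`|a| / 2) by apply: sin_gt0_pi; apply/andP; split; lra.
move=> s; have s2 : 0 < sin (`|a| / 2) ^+ 2 by rewrite exprn_gt0.
by rewrite lt_eqF//; lra.
Qed.

Lemma cos_full_turns j : cos (j%:R * (2 * pi)) = 1 :> R.
Proof.
have := periodicn (@cosD2pi R) j 0; rewrite add0r cos0; apply: etrans.
by rewrite !mulr_natl.
Qed.

Lemma sin_full_turns j : sin (j%:R * (2 * pi)) = 0 :> R.
Proof.
have := periodicn (@sinD2pi R) j 0; rewrite add0r sin0; apply: etrans.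
by rewrite !mulr_natl.
Qed.

Lemma dft_orthogonal (j l : 'I_N) :
  \sum_(k < N) cos ((j%:R - l%:R) * (k%:R * delta)) = (j == l)%:R * N%:R :> R.
Proof.
have [->|jl] := eqVneq j l.
  rewrite mul1r (eq_bigr (fun=> 1)) => [|k _]; last by rewrite subrr mul0r cos0.
  by rewrite sumr_const card_ord.
rewrite mul0r (eq_bigr (fun k : 'I_N => cos (k%:R * ((j%:R - l%:R) * delta)))); last first.
  by move=> k _; rewrite mulrCA.
have NR : 0 < N%:R :> R by rewrite ltr0n.
have Nd : N%:R * ((j%:R - l%:R) * delta) = j%:R * (2 * pi) - l%:R * (2 * pi).
  by rewrite /delta; field; rewrite gt_eqF.
have [||//|//] := @trig_sum0 R N ((j%:R - l%:R) * delta).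
- by rewrite Nd cosB !cos_full_turns !sin_full_turns mulr0 addr0 mulr1.
- by rewrite Nd sinB !cos_full_turns !sin_full_turns mulr0 subr0 mul0r.
apply: cos_freq_neq1; rewrite normr_gt0 mulf_neq0/=; last 2 first.
- rewrite subr_eq0 eqr_nat; exact: jl.
- by rewrite /delta gt_eqF// divr_gt0// mulr_gt0// pi_gt0.
rewrite normrM (@ger0_norm _ delta); last first.
  by rewrite /delta divr_ge0// ?mulr_ge0// ?pi_ge0// ltW.
rewrite /delta mulrA ltr_pdivrMr// mulrC ltr_pM2l ?mulr_gt0 ?pi_gt0//.
have := ltn_ord j; have := ltn_ord l; rewrite -!(ltr_nat R) => lN jN.
have l0 : 0 <= l%:R :> R by []. have j0 : 0 <= j%:R :> R by [].
by rewrite ltr_norml; apply/andP; split; lra.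
Qed.

Lemma dft_plancherel z :
  \sum_(k < N) (dft_cos z k ^+ 2 + dft_sin z k ^+ 2) =
  N%:R * \sum_(j < N) z j ^+ 2.
Proof.
transitivity (\sum_(k < N) \sum_(j < N) \sum_(l < N)
    z j * z l * cos ((j%:R - l%:R) * (k%:R * delta))).
  apply: eq_bigr => k _; rewrite !expr2 /dft_cos /dft_sin !mulr_suml -big_split/=.
  apply: eq_bigr => j _; rewrite !mulr_sumr -big_split/=; apply: eq_bigr => l _.
  by rewrite mulrBl cosB; ring.
rewrite exchange_big mulr_sumr; apply: eq_bigr => j _; rewrite exchange_big/=.
transitivity (\sum_(l < N) z j * z l * ((j == l)%:R * N%:R)).
  by apply: eq_bigr => l _; rewrite -dft_orthogonal mulr_sumr.
rewrite (bigD1 j)//= big1 => [|l lj]; last first.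
  by rewrite eq_sym (negbTE lj) mul0r mulr0.
by rewrite eqxx addr0 mul1r expr2 mulrC.
Qed.

(** A shift by m steps rotates the k-th coefficient by 2 pi k m / N. *)
Lemma dft_shift_diff z m k : (forall j, z (j + N)%N = z j) ->
  let w j := z (j + m)%N - z j in
  dft_cos w k ^+ 2 + dft_sin w k ^+ 2 =
  2 * (1 - cos (m%:R * (k%:R * delta))) * (dft_cos z k ^+ 2 + dft_sin z k ^+ 2).
Proof.
move=> zN w; set b := k%:R * delta.
have Nb : N%:R * b = k%:R * (2 * pi).
  by rewrite /b /delta; field; rewrite pnatr_eq0 -lt0n.
have cb j : cos ((j + N)%:R * b) = cos (j%:R * b).
  by rewrite natrD mulrDl Nb cosD cos_full_turns sin_full_turns mulr1 mulr0 subr0.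
have sb j : sin ((j + N)%:R * b) = sin (j%:R * b).
  by rewrite natrD mulrDl Nb sinD cos_full_turns sin_full_turns mulr1 mulr0 addr0.
have wc : dft_cos w k = (cos (m%:R * b) - 1) * dft_cos z k + sin (m%:R * b) * dft_sin z k.
  rewrite mulrBl mul1r addrAC /dft_cos /dft_sin !mulr_sumr.
  under eq_bigr do rewrite mulrBl; rewrite sumrB -/b; congr (_ - _).
  rewrite -big_split/=.
  pose g j := z j * cos (j%:R * b - m%:R * b).
  transitivity (\sum_(j < N) g (j + m)%N).
    by apply: eq_bigr => j _; rewrite /g natrD mulrDl addrK.
  rewrite sum_periodic_shift => [|j]; last by rewrite /g zN !cosB cb sb.
  by apply: eq_bigr => j _; rewrite /g cosB; ring.
have ws : dft_sin w k = (cos (m%:R * b) - 1) * dft_sin z k - sin (m%:R * b) * dft_cos z k.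
  rewrite mulrBl mul1r addrAC /dft_cos /dft_sin !mulr_sumr.
  under eq_bigr do rewrite mulrBl; rewrite sumrB -/b; congr (_ - _).
  rewrite -sumrB.
  pose g j := z j * sin (j%:R * b - m%:R * b).
  transitivity (\sum_(j < N) g (j + m)%N).
    by apply: eq_bigr => j _; rewrite /g natrD mulrDl addrK.
  rewrite sum_periodic_shift => [|j]; last by rewrite /g zN !sinB cb sb.
  by apply: eq_bigr => j _; rewrite /g sinB; ring.
have := cos2Dsin2 (m%:R * b); rewrite wc ws => e.
have {}e : sin (m%:R * b) ^+ 2 = 1 - cos (m%:R * b) ^+ 2 by lra.
ring: e.
Qed.

(** Among closed polygons with N sides, the regular one has the largest ratio of
    mean square m-step chord to mean square side. By Plancherel it suffices to
    compare the Fourier modes one by one. *)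
Lemma discrete_chord z m : (0 < m < N)%N -> (forall j, z (j + N)%N = z j) ->
  (\sum_(j < N) (z (j + m)%N - z j) ^+ 2) * sin (pi / N%:R) ^+ 2 <=
  (\sum_(j < N) (z j.+1 - z j) ^+ 2) * sin (m%:R * (pi / N%:R)) ^+ 2.
Proof.
move=> mN zN; have NR : 0 < N%:R :> R by rewrite ltr0n.
rewrite -(ler_pM2l NR) [leLHS]mulrA [leRHS]mulrA.
have -> : \sum_(j < N) (z j.+1 - z j) ^+ 2 = \sum_(j < N) (z (j + 1)%N - z j) ^+ 2.
  by apply: eq_bigr => j _; rewrite addn1.
rewrite -(dft_plancherel (fun j => z (j + m)%N - z j)).
rewrite -(dft_plancherel (fun j => z (j + 1)%N - z j)) !mulr_suml.
apply: ler_sum => k _; rewrite !dft_shift_diff// mul1r.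
have := @chord_kernel R k m N (ltn_ord k) mN.
set A := dft_cos z k ^+ 2 + _; have A0 : 0 <= A by rewrite addr_ge0 ?sqr_ge0.
rewrite -/delta => h; have A2 : 0 <= 2 * A by rewrite mulr_ge0.
have := ler_wpM2l A2 h; lra.
Qed.
End DFT.

(** * One-variable calculus *)

Section Calculus.
Variable R : realType.
Notation mu := (@lebesgue_measure R).
Implicit Types (f : R -> R) (a b c : R).

Lemma continuous_shiftr f c :
  continuous f -> continuous (fun t => f (t + c)).
Proof.
move=> cf t; apply: (@continuous_comp _ _ _ (fun u => u + c) f); last exact: cf.
by apply: cvgD; [exact: cvg_id|exact: cvg_cst].
Qed.

Lemma is_derive_shiftr (P : R -> R) (c t p : R) :
  is_derive (t + c) 1 P p -> is_derive t 1 (fun u => P (u + c)) p.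
Proof.
move=> dP; have dc : is_derive t 1 (fun u : R => u + c) 1.
  by apply: is_derive_eq; rewrite addr0.
by have := @is_derive1_comp R P (fun u => u + c) t p 1 dP dc; rewrite mulr1.
Qed.

Lemma is_derive_continuous (f g : R -> R) :
  (forall t : R, is_derive t 1 f (g t)) -> continuous f.
Proof.
move=> df t; apply: differentiable_continuous; apply/derivable1_diffP.
by have := df t => ?; exact: ex_derive.
Qed.

Lemma integrable_itv_continuous f a b : continuous f ->
  mu.-integrable `[a, b] (EFin \o f).
Proof.
move=> cf; apply: continuous_compact_integrable; first exact: segment_compact.
exact: continuous_subspaceT.
Qed.

Lemma Rintegral_cst_itv a b (c : R) : a <= b ->
  \int[mu]_(t in `[a, b]) c = c * (b - a).
Proof.
move=> ab; rewrite Rintegral_cst//; congr (_ * _).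
have := lebesgue_measure_itv `[a, b]; rewrite /= lte_fin.
case: ltP => [_ ->//|ba ->].
by rewrite (@le_anti _ _ a b) ?ab// subrr.
Qed.

Lemma Rintegral_itv_cat f a b c : a <= b -> b <= c ->
  mu.-integrable `[a, c] (EFin \o f) ->
  \int[mu]_(t in `[a, c]) f t - \int[mu]_(t in `[a, b]) f t =
  \int[mu]_(t in `[b, c]) f t.
Proof.
move=> ab bc fi; rewrite (Rintegral_itvB fi) ?bnd_simp//.
rewrite Rintegral_itv_obnd_cbnd//; apply: integrableS fi => //.
by apply: subset_itv; rewrite bnd_simp.
Qed.

Lemma Rintegral_supp f a b : (forall t, ~~ (a < t < b) -> f t = 0) ->
  \int[mu]_(t in [set: R]) f t = \int[mu]_(t in `]a, b[) f t.
Proof.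
move=> f0; rewrite [RHS]Rintegral_mkcond; congr (Rintegral _ _ _).
apply/funext => t; rewrite patchE; case: ifPn => // /negP.
by rewrite inE/= in_itv/= => /negP/f0.
Qed.

Lemma Rintegral_oo_cc f a b : mu.-integrable `[a, b] (EFin \o f) ->
  \int[mu]_(t in `]a, b[) f t = \int[mu]_(t in `[a, b]) f t.
Proof.
move=> fi; rewrite Rintegral_itv_bndo_bndc ?Rintegral_itv_obnd_cbnd//.
- by apply: integrableS fi => //; apply: subset_itv; rewrite bnd_simp.
- by apply: integrableS fi => //; apply: subset_itv; rewrite bnd_simp.
Qed.

Lemma Rintegral_bigsum (I : Type) (s : seq I) (f : I -> R -> R) a b :
  (forall i, mu.-integrable `[a, b] (EFin \o f i)) ->
  mu.-integrable `[a, b] (EFin \o (fun t => \sum_(i <- s) f i t)) /\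
  \int[mu]_(t in `[a, b]) (\sum_(i <- s) f i t) =
  \sum_(i <- s) \int[mu]_(t in `[a, b]) f i t.
Proof.
move=> fi; have fE : EFin \o (fun t => \sum_(i <- s) f i t) =
    (fun t => \sum_(i <- s) (f i t)%:E)%E.
  by apply/funext => t; rewrite /= sumEFin.
have si : mu.-integrable `[a, b] (EFin \o (fun t => \sum_(i <- s) f i t)).
  by rewrite fE; apply: integrable_sum => // i _; exact: fi.
split=> //; apply: EFin_inj; rewrite -sumEFin /Rintegral fineK; last first.
  exact: integrable_fin_num.
under eq_integral do rewrite -sumEFin.
rewrite integral_sum//; apply: eq_bigr => i _; rewrite fineK//.
by apply: integrable_fin_num => //; exact: fi.
Qed.

Lemma EFin_Rintegral (f : R -> R) a b : mu.-integrable `[a, b] (EFin \o f) ->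
  (\int[mu]_(t in `[a, b]) (f t)%:E = (\int[mu]_(t in `[a, b]) f t)%:E)%E.
Proof. by move=> fi; rewrite fineK//; exact: integrable_fin_num. Qed.

(** Integrals of continuous functions are handled through a primitive that is
    differentiable on a whole segment, ends included. *)
Lemma primitive_exists (g : R -> R) (a b : R) : a <= b -> continuous g ->
  exists P : R -> R, (forall x, a <= x <= b -> is_derive x 1 P (g x)) /\
    \int[mu]_(t in `[a, b]) g t = P b - P a.
Proof.
move=> ab cg; have ig u v := integrable_itv_continuous u v cg.
(* the integral starts below a so that P is differentiable at a itself *)
exists (fun x => \int[mu]_(t in `[a - 1, x]) g t); split=> [x /andP[ax xb]|].
  have [||] := @continuous_FTC1_closed R g (a - 1) x (x + 1) _ (ig _ _) _ (cg x).
  - lra.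
  - lra.
  by move=> dP Pg; apply: DeriveDef; [exact: dP|by rewrite -derive1E].
by rewrite Rintegral_itv_cat//; lra.
Qed.

End Calculus.

(** * The chord inequality *)

Section Chord.
Variable R : realType.
Notation mu := (@lebesgue_measure R).

(** The Cauchy-Schwarz inequality for the increments A and B over two intervals
    of lengths a and b and energies p and q. *)
Lemma sq_add_le (A B a b p q : R) : 0 <= a -> 0 <= b -> 0 <= p -> 0 <= q ->
  A ^+ 2 <= a * p -> B ^+ 2 <= b * q -> (A + B) ^+ 2 <= (a + b) * (p + q).
Proof.
move=> a0 b0 p0 q0 hA hB.
have h : (2 * (A * B)) ^+ 2 <= (a * q + b * p) ^+ 2.
  have : A ^+ 2 * B ^+ 2 <= (a * p) * (b * q) by apply: ler_pM; rewrite ?sqr_ge0.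
  have := sqr_ge0 (a * q - b * p); rewrite !expr2; nra.
have : 2 * (A * B) <= a * q + b * p.
  have : 0 <= a * q + b * p by rewrite addr_ge0// mulr_ge0.
  move=> h0; rewrite (le_trans (ler_norm _))// -ler_sqr ?nnegrE//.
  by rewrite real_normK ?num_real.
rewrite !expr2 in hA hB *; nra.
Qed.

(** [e t] is meant as the energy spent on [0, t], the integral of the square of
    the weak derivative; its one link with x is the Cauchy-Schwarz bound [xe]. *)
Variables (x e : R -> R).
Hypothesis xT : periodic x (2 * pi).
Hypothesis e_nd : forall a b : R, 0 <= a -> a <= b -> b <= 2 * pi -> e a <= e b.
Hypothesis xe : forall a b : R, 0 <= a -> a <= b -> b <= 2 * pi ->
  (x b - x a) ^+ 2 <= (b - a) * (e b - e a).

(** The bounds on the sides add up telescopically, except that the last side goes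
    past the end of the period. By periodicity it is the sum of an increment at
    the end of [0, 2 pi] and one at its beginning, whose lengths add up to
    delta. *)
Lemma polygon_energy N (t : R) (delta := 2 * pi / N%:R) : (0 < N)%N ->
  0 <= t <= delta ->
  \sum_(j < N) (x (t + j.+1%:R * delta) - x (t + j%:R * delta)) ^+ 2 <=
    delta * (e (2 * pi) - e 0).
Proof.
move=> N0 /andP[t0 td].
have NR : 0 < N%:R :> R by rewrite ltr0n.
have Nd : N%:R * delta = 2 * pi by rewrite /delta; field; rewrite gt_eqF.
have d0 : 0 <= delta by lra.
case: N N0 @delta td NR Nd d0 => // N _ delta td NR Nd d0.
have Nd' : N%:R * delta + delta = 2 * pi by rewrite -Nd -natr1 mulrDl mul1r.
have in_range j : (j <= N)%N -> j%:R * delta <= N%:R * delta.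
  by move=> jN; rewrite ler_wpM2r// ler_nat.
have pos j : 0 <= j%:R * delta by rewrite mulr_ge0.
have inner M : (M <= N)%N ->
    \sum_(j < M) (x (t + j.+1%:R * delta) - x (t + j%:R * delta)) ^+ 2 <=
    delta * (e (t + M%:R * delta) - e t).
  elim: M => [|M IH] MN; first by rewrite big_ord0 mul0r addr0 subrr mulr0.
  rewrite big_ord_recr/=; have h1 := IH (ltnW MN).
  have Md := in_range _ MN; have p := pos M.
  have e1 : M.+1%:R * delta = M%:R * delta + delta by rewrite -natr1 mulrDl mul1r.
  have := @xe (t + M%:R * delta) (t + M.+1%:R * delta).
  rewrite e1 in Md *; move=> /(_ ltac:(lra) ltac:(lra) ltac:(lra)).
  rewrite (_ : _ - (t + M%:R * delta) = delta); last by ring.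
  by move: h1; set U := \sum_(_ < _) _; lra.
rewrite big_ord_recr/=; have h1 := inner N (leqnn _).
have xl : x (t + N.+1%:R * delta) = x t by rewrite Nd xT.
have x2 : x (2 * pi) = x 0 by rewrite -(xT 0) add0r.
have p := pos N.
have hA := @xe (t + N%:R * delta) (2 * pi) ltac:(lra) ltac:(lra) ltac:(lra).
have hB := @xe 0 t ltac:(lra) ltac:(lra) ltac:(lra).
have eA := @e_nd (t + N%:R * delta) (2 * pi) ltac:(lra) ltac:(lra) ltac:(lra).
have eB := @e_nd 0 t ltac:(lra) ltac:(lra) ltac:(lra).
have := @sq_add_le _ _ _ _ _ _ _ _ _ _ hA hB; rewrite x2.
move=> /(_ ltac:(lra) ltac:(lra) ltac:(lra) ltac:(lra)) h2.
rewrite xl (_ : x t - x (t + N%:R * delta) =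
  x 0 - x (t + N%:R * delta) + (x t - x 0)); last by ring.
rewrite (_ : 2 * pi - _ + _ = delta) in h2; last by lra.
by move: h1 h2; set U := \sum_(_ < _) _; lra.
Qed.

Hypothesis cx : continuous x.

(** A quantitative form of sin a ~ a as a tends to 0. *)
Lemma sin_sq_ge (a : R) : 0 < a -> a <= 1 -> a ^+ 2 * (1 - a ^+ 2) <= sin a ^+ 2.
Proof.
move=> a0 a1; have ds (y : R) : is_derive y 1 sin (cos y) by exact: is_derive_sin.
have cs : {within `[0, a], continuous (@sin R)}.
  exact/continuous_subspaceT/continuous_sin.
have [c] := @MVT R sin cos 0 a a0 (fun x _ => ds x) cs.
rewrite in_itv/= sin0 !subr0 => /andP[c0 ca] ->.
have : 1 - a ^+ 2 / 2 <= cos c.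
  rewrite cos_1B2sin2.
  have pi2 := pi_ge2 R.
  have s0 : 0 <= sin (c / 2) by apply: sin_ge0_pi; apply/andP; split; lra.
  have s1 : sin (c / 2) <= c / 2 by apply: sin_le_id; lra.
  rewrite !expr2; nra.
set C := cos c => hC; rewrite exprMn mulrC ler_wpM2r ?sqr_ge0//.
have : (1 - a ^+ 2 / 2) ^+ 2 <= C ^+ 2.
  rewrite ler_sqr ?nnegrE//; move: hC; rewrite !expr2; nra.
have := sqr_ge0 (a ^+ 2); rewrite !expr2; nra.
Qed.

(** Sampling with N = n M points and integrating over the first sample t in
    [0, delta] gives the inequality up to the factor (theta / sin theta)^2,
    theta = pi / N, which tends to 1 as M grows. *)
Lemma chord_le n h : (0 < h < n)%N ->
  \int[mu]_(t in `[0, 2 * pi]) ((x (t + h%:R * tau R n) - x t) ^+ 2) <=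
  4 * sin (h%:R * (pi / n%:R)) ^+ 2 * (e (2 * pi) - e 0).
Proof.
move=> hn; set s := h%:R * tau R n; set I := Rintegral _ _ _.
set K := e _ - e 0; have pi0 := pi_gt0 R.
have K0 : 0 <= K by rewrite subr_ge0 e_nd//; lra.
have I0 : 0 <= I by apply: Rintegral_ge0 => t _; exact: sqr_ge0.
have n0 : 0 < n%:R :> R by rewrite ltr0n; lia.
pose g t := (x (t + s) - x t) ^+ 2.
have cg : continuous g.
  move=> t; have cd : {for t, continuous (fun t => x (t + s) - x t)}.
    apply: continuousB; last exact: cx.
    apply: continuous_comp; last exact: cx.
    by apply: continuousD => //; exact: cst_continuous.
  exact: (continuousM cd cd).
have pi20 : 0 <= 2 * pi :> R by lra.
have [P [dP IP]] := primitive_exists pi20 cg.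
pose angle M : R := pi / (n * M)%:R.
have main M : (0 < M)%N ->
    I * sin (angle M) ^+ 2 <= 4 * angle M ^+ 2 * (sin (h%:R * (pi / n%:R)) ^+ 2 * K).
  move=> M0; set N := (n * M)%N; set theta := angle M.
  pose delta : R := 2 * pi / N%:R.
  have N0 : (0 < N)%N by rewrite muln_gt0 M0 andbT; lia.
  have MR : 0 < M%:R :> R by rewrite ltr0n.
  have NR : 0 < N%:R :> R by rewrite ltr0n.
  have Nd : N%:R * delta = 2 * pi by rewrite /delta; field; rewrite gt_eqF.
  have d2 : delta = 2 * theta by rewrite /delta /theta /angle -mulrA.
  have th0 : 0 < theta by rewrite divr_gt0.
  have hms : (h * M)%:R * delta = s.
    by rewrite /delta /s /tau /N !natrM; field; rewrite !gt_eqF.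
  have hmt : (h * M)%:R * theta = h%:R * (pi / n%:R).
    by rewrite /theta /angle /N !natrM; field; rewrite !gt_eqF.
  pose c := delta * K * sin (h%:R * (pi / n%:R)) ^+ 2 / sin theta ^+ 2.
  have N2 : (1 < N)%N.
    by apply: (@leq_trans n); [lia|rewrite leq_pmulr].
  have st0 : 0 < sin theta.
    apply: sin_gt0_pi; rewrite th0/= /theta /angle ltr_pdivrMr// ltr_pMr// ltr1n//.
  have sumg t : 0 <= t <= delta -> \sum_(j < N) g (t + j%:R * delta) <= c.
    move=> td; have mN : (0 < h * M < N)%N.
      by case/andP: hn => h1 h2; rewrite muln_gt0 h1 M0 ltn_mul2r M0 h2.
    have := @discrete_chord R N N0 (fun j => x (t + j%:R * delta)) (h * M)%N mN.
    rewrite -/theta hmt => dc.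
    rewrite /c ler_pdivlMr ?exprn_gt0//.
    apply: (@le_trans _ _ ((\sum_(j < N) (x (t + j.+1%:R * delta) -
       x (t + j%:R * delta)) ^+ 2) * sin (h%:R * (pi / n%:R)) ^+ 2)).
      apply: le_trans (dc _).
        rewrite ler_wpM2r ?sqr_ge0//; apply: ler_sum => j _.
        by rewrite /g natrD mulrDl hms addrA.
      by move=> j; rewrite natrD mulrDl Nd addrA xT.
    by rewrite ler_wpM2r ?sqr_ge0// polygon_energy.
  (* the sum over the samples is integrated in t by comparing derivatives *)
  pose Psi t := \sum_(j < N) P (t + j%:R * delta) - c * t.
  have d0 : 0 < delta by rewrite /delta divr_gt0// mulr_gt0.
  have dPsi t : 0 <= t <= delta ->
      is_derive t 1 Psi (\sum_(j < N) g (t + j%:R * delta) - c).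
    move=> /andP[t0 td]; have dP1 (j : 'I_N) :
        is_derive t 1 (fun t => P (t + j%:R * delta)) (g (t + j%:R * delta)).
      have jN : j.+1%:R * delta <= 2 * pi by rewrite -Nd ler_wpM2r ?(ltW d0)// ler_nat.
      have j0 : 0 <= j%:R * delta by rewrite mulr_ge0// ltW.
      apply: is_derive_shiftr; apply: dP; move: jN; rewrite -natr1 => jN.
      by apply/andP; split; lra.
    have -> : Psi = \sum_(j < N) (fun t => P (t + j%:R * delta)) - (c \*: id).
      by apply/funext => u; rewrite /Psi fctE fct_sumE.
    by apply: is_derive_eq; rewrite /GRing.scale/= mulr1.
  have Psi_le : Psi delta <= Psi 0.
    have [||xi] := @MVT R Psi (fun t => \sum_(j < N) g (t + j%:R * delta) - c) 0 delta d0.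
    - by move=> t; rewrite in_itv/= => /andP[? ?]; apply: dPsi; rewrite !ltW.
    - apply: derivable_within_continuous => t; rewrite in_itv/= => /dPsi dt.
      exact: ex_derive.
    rewrite in_itv/= => /andP[xi0 xi1] e1; rewrite -subr_le0 e1 subr0.
    by rewrite mulr_le0_ge0 ?(ltW d0)// subr_le0 sumg// !ltW.
  have tele : Psi delta - Psi 0 = P (2 * pi) - P 0 - c * delta.
    rewrite /Psi mulr0 subr0 addrAC -sumrB -Nd; congr (_ - _).
    have := @telescope_sumr R 0 N (fun j => P (j%:R * delta)) (leq0n N).
    rewrite mul0r => <-; rewrite big_mkord; apply: eq_bigr => j _.
    by rewrite add0r -natr1 mulrDl mul1r [delta + _]addrC.
  rewrite [I]IP.
  have -> : 4 * theta ^+ 2 * (sin (h%:R * (pi / n%:R)) ^+ 2 * K) =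
    c * delta * sin theta ^+ 2.
    by rewrite /c d2; field; rewrite gt_eqF.
  rewrite ler_wpM2r ?sqr_ge0//; lra.
apply/ler_addgt0Pr => eps eps0.
set C := 4 * _ * _.
(* makes angle M <= 4 / M at most 1, and angle M * I at most eps *)
pose M := Num.bound (4 + 4 * I / eps).
have hM : 4 + 4 * I / eps < M%:R.
  by apply: archi_boundP; rewrite addr_ge0// divr_ge0 ?mulr_ge0// ltW.
have Ie : 0 <= 4 * I / eps by rewrite divr_ge0 ?mulr_ge0// ltW.
have MR : 0 < M%:R :> R by lra.
have M0 : (0 < M)%N by rewrite -(ltr_nat R).
have n1 : 1 <= n%:R :> R by rewrite ler1n; lia.
have NR : 0 < (n * M)%:R :> R by rewrite natrM mulr_gt0.
have a0 : 0 < angle M by rewrite divr_gt0.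
have aM : angle M * M%:R <= 4.
  have p4 : pi <= 4 :> R by have := pihalf_lt2 R; lra.
  have e1 : angle M * M%:R * n%:R = pi.
    by rewrite /angle natrM; field; rewrite !gt_eqF.
  have : 0 <= angle M * M%:R by rewrite mulr_ge0// ltW.
  nra.
have a1 : angle M <= 1 by nra.
have aI : angle M * I <= eps.
  have : 4 * I <= eps * M%:R.
    by rewrite [leRHS]mulrC -ler_pdivrMr//; lra.
  nra.
have := main _ M0; have := sin_sq_ge a0 a1.
set S := sin (angle M) ^+ 2 => hS hm.
have : I * (angle M ^+ 2 * (1 - angle M ^+ 2)) <= angle M ^+ 2 * C.
  apply: le_trans (ler_wpM2l I0 hS) _; rewrite /C; move: hm; lra.
rewrite mulrCA ler_pM2l ?exprn_gt0// => hI.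
have : I * angle M ^+ 2 <= eps.
  rewrite expr2 mulrA; nra.
lra.
Qed.
End Chord.

(** * Plateau test functions *)

Section Ramp.
Variable R : realType.
Implicit Types u t c : R.
Notation mu := (@lebesgue_measure R).

Lemma is_derive_quad (f : R -> R) (u d C : R) :
  (forall h, `|f (u + h) - f u - d * h| <= C * h ^+ 2) -> is_derive u 1 f d.
Proof.
move=> fC; have C0 : 0 <= C by have := le_trans (normr_ge0 _) (fC 1); rewrite expr1n mulr1.
have cv : h^-1 *: ((f \o shift u) (h *: 1) - f u) @[h --> 0^'] --> d.
  apply/cvgrPdist_le => eps e0; near=> h.
  have h0 : h != 0 by near: h; exact: nbhs_dnbhs_neq.
  have hC : `|h| * C <= eps.
    have : `|h| <= eps / (C + 1) by near: h; apply: dnbhs0_le; rewrite divr_gt0 ?ltr_wpDl.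
    rewrite ler_pdivlMr ?ltr_wpDl//; apply: le_trans.
    by rewrite ler_wpM2l// lerDl.
  rewrite /= /GRing.scale/= mulr1 [h + u]addrC.
  have -> : d - h^-1 * (f (u + h) - f u) = - (h^-1 * (f (u + h) - f u - d * h)).
    by field.
  rewrite normrN normrM normfV ler_pdivrMl ?normr_gt0//.
  apply: le_trans (fC h) _; rewrite -real_normK ?num_real// expr2 mulrC -mulrA.
  by rewrite ler_wpM2l.
by apply: DeriveDef; [apply/cvg_ex; exists d|apply/cvg_lim].
Unshelve. all: by end_near. Qed.

Definition pospart (u : R) := Num.max 0 u.

Lemma pospart_le0 u : u <= 0 -> pospart u = 0.
Proof. exact: max_l. Qed.

Lemma pospart_ge0 u : 0 <= u -> pospart u = u.
Proof. exact: max_r. Qed.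

Lemma pospartP u : (u <= 0 /\ pospart u = 0) \/ (0 <= u /\ pospart u = u).
Proof.
rewrite /pospart; have [u0|u0] := leP u 0; first by left.
by right; split=> //; exact: ltW.
Qed.

Lemma is_derive_pospart_sq (u : R) :
  is_derive u 1 (fun t => pospart t ^+ 2) (2 * pospart u).
Proof.
apply: (@is_derive_quad _ _ _ 1) => h; rewrite mul1r ler_norml.
have [[u0 ->]|[u0 ->]] := pospartP u; have [[v0 ->]|[v0 ->]] := pospartP (u + h);
  rewrite !expr2; apply/andP; split; nra.
Qed.

Lemma continuous_pospart : continuous pospart.
Proof.
by move=> u; apply: continuous_max; [exact: cst_continuous|exact: cvg_id].
Qed.

Variable h : R.
Hypothesis h0 : 0 < h.

(** A C^1 function that rises from 0 to 1 on [0, 2 h]. It is the integral of a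
    tent of mass 1, a quadratic spline written with truncated squares so that its
    derivative needs no case analysis. *)
Definition ramp u :=
  (pospart u ^+ 2 - 2 * pospart (u - h) ^+ 2 + pospart (u - 2 * h) ^+ 2) /
  (2 * h ^+ 2).

Definition dramp u :=
  (pospart u - 2 * pospart (u - h) + pospart (u - 2 * h)) / h ^+ 2.

Lemma is_derive_ramp (u : R) : is_derive u 1 ramp (dramp u).
Proof.
have d1 c : is_derive u 1 (fun t => pospart (t - c) ^+ 2) (2 * pospart (u - c)).
  exact: (@is_derive_shiftr _ (fun t => pospart t ^+ 2) (- c) u _ (is_derive_pospart_sq _)).
have d0 := is_derive_pospart_sq u.
have -> : ramp = (2 * h ^+ 2)^-1 \*: ((fun t => pospart t ^+ 2) -
    2 \*: (fun t => pospart (t - h) ^+ 2) + (fun t => pospart (t - 2 * h) ^+ 2)).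
  by apply/funext => t; rewrite /ramp mulrC.
apply: is_derive_eq; rewrite /dramp /GRing.scale/=; field.
by rewrite gt_eqF.
Qed.

Lemma continuous_dramp : continuous dramp.
Proof.
have c1 c : continuous (fun t => pospart (t - c)).
  by apply: continuous_shiftr; exact: continuous_pospart.
move=> u; apply: cvgMr_tmp; apply: cvgD; last exact: c1.
apply: cvgB; first exact: continuous_pospart.
by apply: cvgMl_tmp; exact: c1.
Qed.

Lemma ramp_le0 u : u <= 0 -> ramp u = 0 /\ dramp u = 0.
Proof.
move=> u0; have hp := h0; rewrite /ramp /dramp !pospart_le0; [|lra..].
by rewrite expr0n/= !mulr0 subr0 addr0 !mul0r.
Qed.

Lemma ramp_ge u : 2 * h <= u -> ramp u = 1 /\ dramp u = 0.
Proof.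
move=> u0; have hp := h0; rewrite /ramp /dramp !pospart_ge0; [|lra..].
by split; field; rewrite gt_eqF.
Qed.

Lemma ramp_itv01 u : 0 <= ramp u <= 1.
Proof.
have hp := h0; rewrite /ramp; have hh : 0 < 2 * h ^+ 2 by rewrite mulr_gt0// exprn_gt0.
rewrite ler_pdivlMr// ler_pdivrMr// mul0r mul1r.
have [[u0 ->]|[u0 ->]] := pospartP u; have [[v0 ->]|[v0 ->]] := pospartP (u - h);
have [[w0 ->]|[w0 ->]] := pospartP (u - 2 * h); rewrite !expr2; apply/andP; split; nra.
Qed.

Lemma dramp_ge0 u : 0 <= dramp u.
Proof.
have hp := h0; rewrite /dramp divr_ge0 ?sqr_ge0//.
have [[u0 ->]|[u0 ->]] := pospartP u; have [[v0 ->]|[v0 ->]] := pospartP (u - h);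
have [[w0 ->]|[w0 ->]] := pospartP (u - 2 * h); lra.
Qed.

Variables a b : R.
Hypothesis ab : a + 2 * h + 2 * h <= b.

(** A C^1 test function supported in [a, b] and close to its indicator. *)
Definition plateau t := ramp (t - a) - ramp (t - (b - 2 * h)).
Definition dplateau t := dramp (t - a) - dramp (t - (b - 2 * h)).

Lemma is_derive_plateau (t : R) : is_derive t 1 plateau (dplateau t).
Proof.
have d1 c : is_derive t 1 (fun t => ramp (t - c)) (dramp (t - c)).
  exact: is_derive_shiftr (is_derive_ramp _).
have -> : plateau = (fun t => ramp (t - a)) - (fun t => ramp (t - (b - 2 * h))) by [].
exact: is_deriveB.
Qed.

Lemma plateau_out t : ~~ (a < t < b) -> plateau t = 0 /\ dplateau t = 0.
Proof.
have hp := h0; have abp := ab.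
rewrite negb_and -!leNgt => /orP[ta|bt]; rewrite /plateau /dplateau.
  by have [-> ->] := @ramp_le0 (t - a) ltac:(lra);
     have [-> ->] := @ramp_le0 (t - (b - 2 * h)) ltac:(lra); rewrite !subrr.
by have [-> ->] := @ramp_ge (t - a) ltac:(lra);
   have [-> ->] := @ramp_ge (t - (b - 2 * h)) ltac:(lra); rewrite !subrr.
Qed.

Lemma plateau_in t : a + 2 * h <= t <= b - 2 * h -> plateau t = 1.
Proof.
have hp := h0; have abp := ab.
move=> /andP[ta tb]; rewrite /plateau.
by have [-> _] := @ramp_ge (t - a) ltac:(lra);
   have [-> _] := @ramp_le0 (t - (b - 2 * h)) ltac:(lra); rewrite subr0.
Qed.

Lemma plateau_le1 t : `|plateau t| <= 1.
Proof.
have /andP[? ?] := ramp_itv01 (t - a).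
have /andP[? ?] := ramp_itv01 (t - (b - 2 * h)).
by rewrite /plateau ler_norml; apply/andP; split; lra.
Qed.

Lemma derive1_plateau : derive1 plateau = dplateau.
Proof.
apply/funext => t; rewrite derive1E; have := is_derive_plateau t => ?.
exact: derive_val.
Qed.

Lemma continuous_dramp_shift c : continuous (fun t => dramp (t - c)).
Proof.
by apply: continuous_shiftr; exact: continuous_dramp.
Qed.

Lemma continuous_dplateau : continuous dplateau.
Proof. by move=> t; apply: cvgB; exact: continuous_dramp_shift. Qed.

Lemma continuous_plateau : continuous plateau.
Proof.
move=> t; apply: differentiable_continuous; apply/derivable1_diffP.
by have := is_derive_plateau t => ?; exact: ex_derive.
Qed.

Lemma plateau_test : test_function plateau.
Proof.
have hp := h0; have abp := ab.
split.
- by move=> t; have := is_derive_plateau t => ?; exact: ex_derive.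
- by rewrite derive1_plateau; exact: continuous_dplateau.
- exists (Num.max `|a| `|b|) => t; rewrite gt_max => /andP[ta tb].
  apply: (proj1 (plateau_out _)); apply/negP => /andP[at_ tb_].
  have [t0|t0] := leP 0 t.
    by move: tb; rewrite (ger0_norm t0) (ger0_norm (x := b)); lra.
  by move: ta; rewrite (ltr0_norm t0) (ltr0_norm (x := a)); lra.
Qed.

Lemma integral_dramp c : a <= c -> c <= b - 2 * h ->
  \int[mu]_(t in `[a, b]) dramp (t - c) = 1.
Proof.
have hp := h0; have abp := ab.
move=> ac cb; rewrite /Rintegral.
rewrite (@continuous_FTC2 R (fun t => dramp (t - c)) (fun t => ramp (t - c)) a b).
- have [-> _] := @ramp_ge (b - c) ltac:(lra).
  by have [-> _] := @ramp_le0 (a - c) ltac:(lra); rewrite sube0.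
- lra.
- exact/continuous_subspaceT/continuous_dramp_shift.
- have d1 (t : R) : is_derive t 1 (fun t => ramp (t - c)) (dramp (t - c)).
    exact: is_derive_shiftr (is_derive_ramp _).
  have cd t : {for t, continuous (fun t => ramp (t - c))}.
    apply: differentiable_continuous; apply/derivable1_diffP.
    by have := d1 t => ?; exact: ex_derive.
  split; first by move=> t _; have := d1 t => ?; exact: ex_derive.
  + exact: cvg_at_right_filter (cd _).
  + exact: cvg_at_left_filter (cd _).
- move=> t _; rewrite derive1E.
  have d1 : is_derive t 1 (fun t => ramp (t - c)) (dramp (t - c)).
    exact: is_derive_shiftr (is_derive_ramp _).
  exact: derive_val.
Qed.
End Ramp.

(** * Weak derivatives of functions of one variable *)

Section WeakFTC.
Variable R : realType.
Notation mu := (@lebesgue_measure R).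
Implicit Types (a b t h eta : R) (f : R -> R).

Lemma L2loc_integrable_sq f a b : L2loc f ->
  mu.-integrable `[a, b] (EFin \o (fun t => f t ^+ 2)).
Proof.
move=> [mf [mf2 _ lf]]; apply/integrableP; split.
  by apply/measurable_EFinP; exact: measurable_funTS.
by apply: lf => //; exact: segment_compact.
Qed.

Lemma L2loc_integrable f a b : L2loc f -> mu.-integrable `[a, b] (EFin \o f).
Proof.
move=> Lf; have i2 := L2loc_integrable_sq a b Lf.
have i1 := integrable_itv_continuous a b (@cst_continuous _ _ (1 : R)).
apply: le_integrable (integrableD _ i2 i1) => //.
  by apply/measurable_EFinP; apply: measurable_funTS; case: Lf.
move=> t _ /=; rewrite lee_fin [leRHS]ger0_norm ?addr_ge0 ?sqr_ge0//.
rewrite -real_normK ?num_real//; have := sqr_ge0 (`|f t| - 1); rewrite !expr2; nra.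
Qed.

Lemma L2loc_locally_integrable f : L2loc f -> locally_integrable [set: R] f.
Proof.
move=> Lf; split; [by case: Lf|exact: openT|move=> K _ cK].
have [M [_ hM]] := compact_bounded cK.
have sub : K `<=` `[- (M + 1), M + 1].
  move=> t /(hM (M + 1) _)-/(_ _)/=; rewrite ltrDl => /(_ ltr01).
  by rewrite in_itv/= -ler_norml.
have := L2loc_integrable (- (M + 1)) (M + 1) Lf.
have mK := compact_measurable cK.
move=> fi; have /integrableP[]// : mu.-integrable K (EFin \o f).
exact: integrableS fi.
Qed.

Variables x v : R -> R.
Hypothesis cx : continuous x.
Hypothesis Lv : L2loc v.
Hypothesis xv : forall phi : R -> R, test_function phi ->
  \int[mu]_(t in [set: R]) (x t * derive1 phi t) =
  - \int[mu]_(t in [set: R]) (v t * phi t).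

(** The derivative of a plateau is the difference of two tents of mass 1, located
    where x is within eta of x a and of x b respectively. Testing the weak
    derivative against it therefore yields x b - x a up to 2 eta. *)
Lemma weak_plateau a b h eta : 0 < h -> a + 2 * h + 2 * h <= b ->
  (forall t, `|t - a| <= 2 * h -> `|x t - x a| <= eta) ->
  (forall t, `|t - b| <= 2 * h -> `|x t - x b| <= eta) ->
  `|\int[mu]_(t in `]a, b[) (v t * plateau h a b t) - (x b - x a)| <= 2 * eta.
Proof.
move=> h0 ab xa xb.
have <- : \int[mu]_(t in [set: R]) (v t * plateau h a b t) =
    \int[mu]_(t in `]a, b[) (v t * plateau h a b t).
  by apply: Rintegral_supp => t /(plateau_out h0 ab)[-> _]; rewrite mulr0.
have cd := @continuous_dplateau R h a b.
have cxd : continuous (fun t => x t * dplateau h a b t).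
  by move=> t; apply: continuousM; [exact: cx|exact: cd].
have := xv (plateau_test h0 ab); rewrite (derive1_plateau h0).
rewrite (@Rintegral_supp _ _ a b) => [|t /(plateau_out h0 ab)[_ ->]]; last by rewrite mulr0.
rewrite Rintegral_oo_cc; last exact: integrable_itv_continuous.
move=> e; rewrite -[X in X - _]opprK -e.
set I := Rintegral _ _ _.
have c1 c : continuous (fun t => dramp h (t - c)) := @continuous_dramp_shift R h c.
have cc1 k c : continuous (fun t => k * dramp h (t - c)).
  by move=> t; apply: cvgMl_tmp; exact: c1.
have comb k1 k2 : \int[mu]_(t in `[a, b])
    (k1 * dramp h (t - a) - k2 * dramp h (t - (b - 2 * h))) = k1 - k2.
  rewrite RintegralB//; [|exact: integrable_itv_continuous..].
  rewrite !RintegralZl//; [|exact: integrable_itv_continuous..].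
  by rewrite !integral_dramp// ?mulr1//; lra.
have icomb k1 k2 : mu.-integrable `[a, b]
    (EFin \o (fun t => k1 * dramp h (t - a) - k2 * dramp h (t - (b - 2 * h)))).
  apply: integrable_itv_continuous => t; apply: cvgB; exact: cc1.
have p1 t : `|x t * dramp h (t - a) - x a * dramp h (t - a)| <= eta * dramp h (t - a).
  rewrite -mulrBl normrM (ger0_norm (dramp_ge0 h0 _)).
  have [ta|ta] := leP `|t - a| (2 * h).
    by rewrite ler_wpM2r ?xa// dramp_ge0.
  suff -> : dramp h (t - a) = 0 by rewrite !mulr0.
  have [ta0|ta0] := leP 0 (t - a).
    by have [] := @ramp_ge _ _ h0 (t - a); rewrite -1?(ger0_norm ta0) ?ltW.
  by have [] := @ramp_le0 _ _ h0 (t - a) (ltW ta0).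
have p2 t : `|x t * dramp h (t - (b - 2 * h)) - x b * dramp h (t - (b - 2 * h))| <=
    eta * dramp h (t - (b - 2 * h)).
  rewrite -mulrBl normrM (ger0_norm (dramp_ge0 h0 _)).
  have [tb|tb] := leP `|t - b| (2 * h).
    by rewrite ler_wpM2r ?xb// dramp_ge0.
  suff -> : dramp h (t - (b - 2 * h)) = 0 by rewrite !mulr0.
  move: tb; have [tb0|tb0] := leP 0 (t - b).
    rewrite (ger0_norm tb0) => tb.
    by have [] := @ramp_ge _ _ h0 (t - (b - 2 * h)) ltac:(lra).
  rewrite (ltr0_norm tb0) => tb.
  by have [] := @ramp_le0 _ _ h0 (t - (b - 2 * h)) ltac:(lra).
have up : I <= (x a + eta) - (x b - eta).
  rewrite -comb; apply: le_Rintegral => //; first exact: integrable_itv_continuous.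
  move=> t _; have := p1 t; have := p2 t; rewrite !ler_norml /dplateau.
  by move=> /andP[? ?] /andP[? ?]; lra.
have lo : (x a - eta) - (x b + eta) <= I.
  rewrite -comb; apply: le_Rintegral => //; first exact: integrable_itv_continuous.
  move=> t _; have := p1 t; have := p2 t; rewrite !ler_norml /dplateau.
  by move=> /andP[? ?] /andP[? ?]; lra.
rewrite ler_norml; apply/andP; split; lra.
Qed.

(** The plateaus converge to the indicator of ]a, b[ when their ramps shrink;
    dominated convergence passes to the limit in the integral. *)
Lemma weak_ftc a b : a <= b -> x b - x a = \int[mu]_(t in `[a, b]) v t.
Proof.
rewrite le_eqVlt => /predU1P[->|ab].
  by rewrite subrr set_itv1 Rintegral_set1.
pose h n : R := (b - a) / 4 * n.+1%:R^-1.
have h0 n : 0 < h n by rewrite mulr_gt0 ?divr_gt0 ?subr_gt0 ?invr_gt0.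
have hle n : h n <= (b - a) / 4.
  by rewrite ler_piMr ?invf_le1 ?ler1n// divr_ge0 ?subr_ge0// ltW.
have abh n : a + 2 * h n + 2 * h n <= b by have := hle n; lra.
have hsmall eps : 0 < eps -> \forall n \near \oo, 2 * h n <= eps.
  move=> e0; have k0 : 0 < 2 * ((b - a) / 4) by lra.
  have q0 : 0 < eps / (2 * ((b - a) / 4)) by rewrite divr_gt0.
  near=> n; rewrite /h mulrA -ler_pdivlMl// mulrC ltW//.
  by near: n; exact: (near_infty_natSinv_lt (PosNum q0)).
pose U n := \int[mu]_(t in `]a, b[) (v t * plateau (h n) a b t).
have U1 : U n @[n --> \oo] --> x b - x a.
  apply/cvgrPdist_le => eps e0.
  have e2 : 0 < eps / 2 by rewrite divr_gt0.
  have near_c c : exists2 d : R, 0 < d & forall t, `|t - c| < d -> `|x t - x c| <= eps / 2.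
    have /cvgrPdist_le/(_ _ e2) := @cx c.
    move=> /nbhs_ballP[d d0 hd]; exists d => // t td.
    by rewrite distrC; apply: hd; rewrite /ball/= distrC.
  have [d1 d10 hd1] := near_c a; have [d2 d20 hd2] := near_c b.
  have d30 : 0 < Num.min d1 d2 / 2 by rewrite divr_gt0// lt_min d10.
  near=> n; rewrite distrC.
  have hn : 2 * h n <= Num.min d1 d2 / 2 by near: n; exact: hsmall.
  have hn1 : 2 * h n < Num.min d1 d2 by apply: le_lt_trans hn _; lra.
  move: hn1; rewrite lt_min => /andP[hn1 hn2].
  have := @weak_plateau a b (h n) (eps / 2) (h0 n) (abh n).
  rewrite (_ : 2 * (eps / 2) = eps); last by field.
  apply.
  - by move=> t ta; apply: hd1; exact: le_lt_trans hn1.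
  - by move=> t ta; apply: hd2; exact: le_lt_trans hn2.
have iv : mu.-integrable `]a, b[ (EFin \o v).
  apply: integrableS (L2loc_integrable a b Lv) => //.
  by apply: subset_itv; rewrite bnd_simp.
have mv A : measurable_fun A v by apply: measurable_funTS; case: Lv.
have mp n : measurable_fun `]a, b[ (fun t => v t * plateau (h n) a b t).
  apply: measurable_funM => //; apply: measurable_funTS.
  by apply: continuous_measurable_fun; exact: continuous_plateau.
have U2 : U n @[n --> \oo] --> \int[mu]_(t in `]a, b[) v t.
  apply: fine_cvg; rewrite fineK ?integrable_fin_num//.
  have mvE : measurable_fun `]a, b[ (EFin \o v) by apply/measurable_EFinP.
  have mpE n : measurable_fun `]a, b[ (fun t => (v t * plateau (h n) a b t)%:E).
    by apply/measurable_EFinP.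
  have [] // := @dominated_convergence _ _ R mu `]a, b[ (measurable_itv _)
    (fun n t => (v t * plateau (h n) a b t)%:E) (EFin \o v)
    (fun t => `|v t|%:E) mpE mvE.
  - apply/aeW => t; rewrite /= in_itv/= => /andP[ta tb].
    apply: cvg_near_cst; have d0 : 0 < Num.min (t - a) (b - t).
      by rewrite lt_min !subr_gt0 ta.
    near=> n; have : 2 * h n <= Num.min (t - a) (b - t) by near: n; exact: hsmall.
    rewrite le_min => /andP[h1 h2]; rewrite plateau_in ?mulr1//.
    by apply/andP; split; lra.
  - exact: integrable_norm iv.
  - apply/aeW => t n _ /=; rewrite lee_fin normrM.
    by rewrite ler_piMr// plateau_le1.
rewrite -Rintegral_oo_cc; last exact: L2loc_integrable.
exact: (cvg_unique _ U1 U2).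
Unshelve. all: by end_near. Qed.

(** Integrate (v - l)^2 >= 0 over [a, b], with l the mean of v there. *)
Lemma weak_cauchy_schwarz a b : a <= b ->
  (x b - x a) ^+ 2 <= (b - a) * \int[mu]_(t in `[a, b]) (v t ^+ 2).
Proof.
rewrite le_eqVlt => /predU1P[->|ab]; first by rewrite !subrr mul0r expr0n.
rewrite (weak_ftc (ltW ab)); set D := (X in X ^+ 2 <= _); set E := (X in _ <= _ * X).
have ba0 : 0 < b - a by rewrite subr_gt0.
pose l := D / (b - a); have lD : l * (b - a) = D by rewrite divfK// gt_eqF.
have iv := L2loc_integrable a b Lv; have iv2 := L2loc_integrable_sq a b Lv.
have icst k : mu.-integrable `[a, b] (EFin \o (fun=> k : R)).
  exact: integrable_itv_continuous (@cst_continuous _ _ k).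
have ilv : mu.-integrable `[a, b] (EFin \o (fun t => 2 * l * v t)).
  by apply: eq_integrable (integrableZl _ (2 * l) iv).
have : \int[mu]_(t in `[a, b]) (2 * l * v t) <=
       \int[mu]_(t in `[a, b]) (v t ^+ 2 + l ^+ 2).
  apply: le_Rintegral => //; first exact: (integrableD _ iv2 (icst _)).
  by move=> t _; have := sqr_ge0 (v t - l); rewrite !expr2; lra.
rewrite RintegralD// RintegralZl// (Rintegral_cst_itv _ (ltW ab)) -/D -/E => h1.
have := ler_wpM2l (ltW ba0) h1; rewrite -lD !expr2; lra.
Qed.

(** At its Lebesgue points, v is the derivative of its own primitive, which is x
    up to a constant. The primitive has to start at some point; -1 leaves the
    period [0, 2 pi] to its right. *)
Lemma weak_derivative_ae (dx : R -> R) : (forall t : R, is_derive t 1 x (dx t)) ->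
  {ae mu, forall t, -1 < t -> v t = dx t}.
Proof.
move=> xdx.
have iv y : mu.-integrable [set` Interval (BLeft (-1)) (BRight y)] (EFin \o v).
  exact: L2loc_integrable.
have := FTC1 iv (L2loc_locally_integrable Lv).
apply: filterS; first exact: (ae_filter_ringOfSetsType mu).
move=> t /= h t1; have {h} [|_ <-] := h; first by rewrite lte_fin.
rewrite derive1E; have -> : dx t = 'D_1 (fun u => x u - x (-1)) t.
  have ? := xdx t; have ? : is_derive t 1 (fun u => x u - x (-1)) (dx t).
    by apply: is_derive_eq; rewrite subr0.
  by rewrite derive_val.
apply: near_eq_derive.
near=> u; rewrite weak_ftc//.
by apply: ltW; near: u; exact: lt_nbhsr.
Unshelve. all: by end_near. Qed.
End WeakFTC.

Section WeakClassical.
Variable R : realType.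
Notation mu := (@lebesgue_measure R).

Lemma continuous_L2loc (f : R -> R) : continuous f -> L2loc f.
Proof.
move=> cf; have cf2 : continuous (fun t => f t ^+ 2).
  by move=> t; exact: (continuousM (@cf t) (@cf t)).
split; first exact: continuous_measurable_fun.
split; [exact: continuous_measurable_fun|exact: openT|move=> K _ cK].
have /integrableP[] // : mu.-integrable K (EFin \o (fun t => f t ^+ 2)).
by apply: continuous_compact_integrable => //; exact: continuous_subspaceT.
Qed.

Lemma is_derive_LRcontinuous (f g : R -> R) a b :
  (forall t : R, is_derive t 1 f (g t)) -> derivable_oo_LRcontinuous f a b.
Proof.
move=> df; have cf := is_derive_continuous df; split.
- by move=> t _; have := df t => ?; exact: ex_derive.
- exact: cvg_at_right_filter (cf _).
- exact: cvg_at_left_filter (cf _).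
Qed.

Lemma classical_weak_derivative (f g phi : R -> R) :
  (forall t : R, is_derive t 1 f (g t)) -> continuous g -> test_function phi ->
  \int[mu]_(t in [set: R]) (f t * derive1 phi t) =
  - \int[mu]_(t in [set: R]) (g t * phi t).
Proof.
move=> df cg [dphi cphi [M phi0]]; pose b := `|M| + 1.
have dp (t : R) : is_derive t 1 phi (derive1 phi t).
  by rewrite derive1E; exact/derivableP.
have cf := is_derive_continuous df; have cp := is_derive_continuous dp.
have b0 : 0 < b by rewrite ltr_wpDl.
have out (t : R) : ~~ (- b < t < b) -> M < `|t|.
  rewrite -ltr_norml -leNgt; apply: lt_le_trans.
  by rewrite (le_lt_trans (ler_norm _))// ltrDl.
have dout (t : R) : ~~ (- b < t < b) -> derive1 phi t = 0.
  move=> /out Mt; rewrite derive1E (_ : 'D_1 phi t = 'D_1 (cst 0 : R -> R) t).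
    exact: derive_cst.
  apply: near_eq_derive; near=> u; apply: phi0; near: u.
  have nt : `|u| @[u --> t] --> `|t| by exact: norm_continuous.
  by apply: (@cvgr_gt _ _ _ _ (fun u : R => `|u|) _ nt); exact: Mt.
rewrite (@Rintegral_supp _ _ (- b) b) => [|t /dout->]; last by rewrite mulr0.
rewrite (@Rintegral_supp _ _ (- b) b) => [|t /out/phi0->]; last by rewrite mulr0.
rewrite !Rintegral_oo_cc; last 2 first.
- by apply: integrable_itv_continuous => t; apply: continuousM; [exact: cg|exact: cp].
- by apply: integrable_itv_continuous => t; apply: continuousM; [exact: cf|exact: cphi].
rewrite (@Rintegration_by_parts R f phi g (derive1 phi)).
- rewrite !phi0 ?mulr0 ?subrr ?sub0r//; apply: out; rewrite ltxx ?andbF//.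
- by rewrite gt0_cp.
- exact: continuous_subspaceT.
- exact: is_derive_LRcontinuous df.
- by move=> t _; have ? := df t; rewrite derive1E derive_val.
- exact: continuous_subspaceT.
- exact: is_derive_LRcontinuous dp.
- by [].
Unshelve. all: by end_near. Qed.
End WeakClassical.

Section Euclid.
Variables (R : realType) (d : nat).
Implicit Types (u w : 'rV[R]_d) (a b : R).

Lemma dotv_ge0 u : 0 <= dotv u u.
Proof. by apply: sumr_ge0 => i _; rewrite -expr2 sqr_ge0. Qed.

Lemma enorm_sq u : enorm u ^+ 2 = dotv u u.
Proof. by rewrite /enorm sqr_sqrtr// dotv_ge0. Qed.

Lemma enorm_sum_sq u : enorm u ^+ 2 = \sum_i u ord0 i ^+ 2.
Proof. by rewrite enorm_sq; apply: eq_bigr => i _; rewrite expr2. Qed.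

Lemma enorm_ge0 u : 0 <= enorm u.
Proof. exact: sqrtr_ge0. Qed.

Lemma enorm_gt0 u : u != 0 -> 0 < enorm u.
Proof.
move=> u0; rewrite lt_neqAle enorm_ge0 andbT; apply: contra u0 => /eqP e.
have : enorm u ^+ 2 = 0 by rewrite -e expr0n.
rewrite enorm_sum_sq => /eqP; rewrite psumr_eq0 => [/allP h|i _]; last exact: sqr_ge0.
apply/eqP/rowP => i; rewrite mxE; apply/eqP; rewrite -sqrf_eq0.
by apply: h; rewrite mem_index_enum.
Qed.

Lemma dotv_comb u w a b a' b' : dotv u u = 1 -> dotv w w = 1 -> dotv u w = 0 ->
  dotv (a *: u + b *: w) (a' *: u + b' *: w) = a * a' + b * b'.
Proof.
move=> uu ww uw.
have -> : dotv (a *: u + b *: w) (a' *: u + b' *: w) = a * a' * dotv u u +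
    b * b' * dotv w w + (a * b' + b * a') * dotv u w.
  rewrite /dotv !mulr_sumr -!big_split/=; apply: eq_bigr => i _.
  by rewrite !mxE; ring.
by rewrite uu ww uw; ring.
Qed.
End Euclid.

(** * Uniform circular motion *)

Section Circle.
Variables (R : realType) (d : nat) (u w : 'rV[R]_d) (r : R).
Hypotheses (uu : dotv u u = 1) (ww : dotv w w = 1) (uw : dotv u w = 0).
Hypothesis r0 : 0 < r.
Notation mu := (@lebesgue_measure R).

Definition circle (t : R) := (r * cos t) *: u + (r * sin t) *: w.
Definition dcircle (t : R) := (- (r * sin t)) *: u + (r * cos t) *: w.

Lemma is_derive_circle_coord i (t : R) :
  is_derive t 1 (fun s => circle s ord0 i) (dcircle t ord0 i).
Proof.
have -> : (fun s => circle s ord0 i) =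
    (r * u ord0 i) \*: (@cos R) + (r * w ord0 i) \*: (@sin R).
  apply/funext => s; rewrite !mxE /=.
  transitivity (r * u ord0 i * cos s + r * w ord0 i * sin s) => //; ring.
have ? := is_derive_cos t; have ? := is_derive_sin t.
by apply: is_derive_eq; rewrite !mxE /GRing.scale/=; ring.
Qed.

Lemma is_derive_dcircle_coord i (t : R) :
  is_derive t 1 (fun s => dcircle s ord0 i) (- circle t ord0 i).
Proof.
have -> : (fun s => dcircle s ord0 i) =
    (- (r * u ord0 i)) \*: (@sin R) + (r * w ord0 i) \*: (@cos R).
  apply/funext => s; rewrite !mxE /=.
  transitivity (- (r * u ord0 i) * sin s + r * w ord0 i * cos s) => //; ring.
have ? := is_derive_cos t; have ? := is_derive_sin t.
by apply: is_derive_eq; rewrite !mxE /GRing.scale/=; ring.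
Qed.

Lemma circle_diff s t : enorm (circle s - circle t) = 2 * r * `|sin ((s - t) / 2)|.
Proof.
have -> : circle s - circle t =
    (r * (cos s - cos t)) *: u + (r * (sin s - sin t)) *: w.
  by apply/rowP => i; rewrite !mxE; ring.
rewrite /enorm dotv_comb//.
have -> : r * (cos s - cos t) * (r * (cos s - cos t)) +
    r * (sin s - sin t) * (r * (sin s - sin t)) = (2 * r * sin ((s - t) / 2)) ^+ 2.
  transitivity (r ^+ 2 * ((cos s ^+ 2 + sin s ^+ 2) + (cos t ^+ 2 + sin t ^+ 2) -
      2 * (cos s * cos t + sin s * sin t))); first by ring.
  by rewrite !cos2Dsin2 -cosB cos_1B2sin2; ring.
by rewrite sqrtr_sqr normrM ger0_norm// mulr_ge0// ltW.
Qed.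

Lemma enorm_dcircle t : enorm (dcircle t) = r.
Proof.
rewrite /enorm dotv_comb// -[X in Num.sqrt X](_ : r ^+ 2 = _).
  by rewrite sqrtr_sqr gtr0_norm.
transitivity (r ^+ 2 * (cos t ^+ 2 + sin t ^+ 2)); last by ring.
by rewrite cos2Dsin2 mulr1.
Qed.

Lemma continuous_circle : continuous circle.
Proof.
move=> t; apply: cvgD; apply: cvgZr_tmp; apply: cvgMl_tmp.
- exact: continuous_cos.
- exact: continuous_sin.
Qed.

Lemma circle_periodic : periodic circle (2 * pi).
Proof.
by move=> t; rewrite /circle -[2]/(1 *+ 2) mulr_natl sinD2pi cosD2pi.
Qed.

Lemma circle_weak_derivative : is_weak_derivative circle dcircle.
Proof.
move=> i; have cd : continuous (fun t => dcircle t ord0 i).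
  exact: is_derive_continuous (is_derive_dcircle_coord i).
split; first exact: continuous_L2loc.
move=> phi; apply: classical_weak_derivative => //.
exact: is_derive_circle_coord.
Qed.

Lemma circle_H1 : H1_2pi circle.
Proof.
split; [exact: continuous_circle|exact: circle_periodic| |].
  move=> i; apply: continuous_L2loc.
  exact: is_derive_continuous (is_derive_circle_coord i).
by exists dcircle; exact: circle_weak_derivative.
Qed.

Lemma half_angle n h : (h%:R * tau R n) / 2 = h%:R * (pi / n%:R).
Proof. by rewrite /tau; set k := n%:R^-1; field. Qed.

Lemma sin_half_angle_gt0 n h : (0 < h < n)%N -> 0 < sin (h%:R * (pi / n%:R)) :> R.
Proof.
move=> /andP[h0 hn]; have n0 : 0 < n%:R :> R by rewrite ltr0n; lia.
have pi0 := pi_gt0 R.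
apply: sin_gt0_pi; rewrite mulr_gt0 ?ltr0n ?divr_gt0//= mulrA ltr_pdivrMr//.
by rewrite mulrC ltr_pM2l// ltr_nat.
Qed.

Lemma circle_chord n h t : (0 < h < n)%N ->
  enorm (circle t - circle (t + h%:R * tau R n)) = 2 * r * sin (h%:R * (pi / n%:R)).
Proof.
move=> hn; rewrite circle_diff opprD addrA subrr add0r mulNr sinN normrN half_angle.
by rewrite gtr0_norm// sin_half_angle_gt0.
Qed.

Lemma circle_Lambda n : Lambda n circle.
Proof.
split; first exact: circle_H1.
move=> t h hn e; have hn' : (0 < h < n)%N by lia.
have := circle_chord t hn'; rewrite -e subrr /enorm /dotv big1 => [|i _].
  rewrite sqrtr0 => /eqP; rewrite eq_sym gt_eqF// !mulr_gt0//.
  exact: sin_half_angle_gt0.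
by rewrite mxE mul0r.
Qed.

Lemma measurable_enorm_sq (v : R -> 'rV[R]_d) (A : set R) :
  (forall i, measurable_fun [set: R] (fun t => v t ord0 i)) ->
  measurable_fun A (fun t => (enorm (v t) ^+ 2)).
Proof.
move=> mv; rewrite (_ : (fun t => _) = (fun t => \sum_(i < d) v t ord0 i ^+ 2)).
  by apply: measurable_sum => i; apply: measurable_funX; exact: measurable_funTS.
by apply/funext => t; rewrite enorm_sum_sq.
Qed.

Lemma weak_deriv_spec (x : R -> 'rV[R]_d) :
  H1_2pi x -> is_weak_derivative x (weak_deriv x).
Proof. by move=> [_ _ _]; exact: getPex. Qed.

Lemma integral_cst_itv (c : R) :
  (\int[mu]_(t in `[0%R, (2 * pi)%R]) c%:E = (c * (2 * pi))%:E)%E.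
Proof.
have pi0 := pi_gt0 R.
rewrite integral_cst//= EFinM; congr (_ * _)%E.
have := lebesgue_measure_itv `[(0 : R), 2 * pi]; rewrite /= lte_fin mulr_gt0// => ->.
by rewrite sube0.
Qed.

(** The weak derivative in the action is an arbitrary representative; its norm is
    known to be r only almost everywhere. *)
Lemma circle_kinetic :
  (\int[mu]_(t in `[0%R, (2 * pi)%R]) ((enorm (weak_deriv circle t)) ^+ 2)%:E =
   (r ^+ 2 * (2 * pi))%:E)%E.
Proof.
have wd := weak_deriv_spec circle_H1.
rewrite -integral_cst_itv; apply: ae_eq_integral => //.
- apply/measurable_EFinP; apply: measurable_enorm_sq => i.
  by have [[]] := wd i.
- have ae i : {ae mu, forall t, -1 < t -> weak_deriv circle t ord0 i = dcircle t ord0 i}.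
    have [L W] := wd i; apply: weak_derivative_ae W _ _ => //.
      exact: is_derive_continuous (is_derive_circle_coord i).
    exact: is_derive_circle_coord.
  have aeall : {ae mu, forall t, forall i, -1 < t ->
      weak_deriv circle t ord0 i = dcircle t ord0 i}.
    exact: filter_forall ae.
  apply: filterS aeall; first exact: (ae_filter_ringOfSetsType mu).
  move=> t h /=; rewrite in_itv/= => /andP[t0 _].
  rewrite -(enorm_dcircle t) !enorm_sum_sq; congr (_%:E).
  by apply: eq_bigr => i _; rewrite h//; lra.
Qed.

(** The potential, up to sign, created at a vertex of the regular n-gon of
    circumradius r by the other vertices. *)
Definition ngon_potential n alpha :=
  \sum_(1 <= h < n) ((2 * r * sin (h%:R * (pi / n%:R))) `^ alpha)^-1.

Lemma circle_action n alpha :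
  action n alpha circle = (pi * r ^+ 2 + pi * ngon_potential n alpha)%:E.
Proof.
rewrite /action circle_kinetic.
rewrite (eq_big_nat _ _ (F2 := fun h => ((((2 * r * sin (h%:R * (pi / n%:R))) `^ alpha)^-1 *
   (2 * pi))%:E))); last first.
  move=> h hn; rewrite -integral_cst_itv; apply: eq_integral => t _.
  by rewrite circle_chord.
rewrite sumEFin -!EFinM -EFinD; congr (_%:E).
rewrite -mulr_suml -/(ngon_potential n alpha); by field.
Qed.
End Circle.

(** * The rotating regular polygon *)

Section Rotation.
Variables (R : realType) (d : nat) (u w : 'rV[R]_d).
Hypotheses (uu : dotv u u = 1) (ww : dotv w w = 1) (uw : dotv u w = 0).

Definition plane_proj : 'M[R]_d := u^T *m u + w^T *m w.
Definition plane_turn : 'M[R]_d := u^T *m w - w^T *m u.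
(** The exponential of t times [plane_turn]: the rotation by t in the plane of u
    and w, and the identity on its orthogonal complement. *)
Definition plane_rotation (t : R) : 'M[R]_d :=
  1%:M + (cos t - 1) *: plane_proj + sin t *: plane_turn.

Lemma mul_outer (a b c : 'rV[R]_d) : a *m (b^T *m c) = dotv a b *: c.
Proof.
rewrite mulmxA; have -> : a *m b^T = (dotv a b)%:M.
  apply/matrixP => i j; rewrite !ord1 !mxE eqxx mulr1n.
  by apply: eq_bigr => k _; rewrite !mxE.
by rewrite mul_scalar_mx.
Qed.

Lemma dotvC (a b : 'rV[R]_d) : dotv a b = dotv b a.
Proof. by apply: eq_bigr => i _; rewrite mulrC. Qed.

Let wu : dotv w u = 0. Proof. by rewrite dotvC. Qed.

Lemma u_proj : u *m plane_proj = u.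
Proof. by rewrite mulmxDr !mul_outer uu uw scale1r scale0r addr0. Qed.
Lemma w_proj : w *m plane_proj = w.
Proof. by rewrite mulmxDr !mul_outer ww wu scale1r scale0r add0r. Qed.
Lemma u_turn : u *m plane_turn = w.
Proof. by rewrite mulmxBr !mul_outer uu uw scale1r scale0r subr0. Qed.
Lemma w_turn : w *m plane_turn = - u.
Proof. by rewrite mulmxBr !mul_outer ww wu scale1r scale0r sub0r. Qed.

Lemma proj_proj : plane_proj *m plane_proj = plane_proj.
Proof. by rewrite {1}/plane_proj mulmxDl -!mulmxA u_proj w_proj. Qed.
Lemma turn_proj : plane_turn *m plane_proj = plane_turn.
Proof. by rewrite {1}/plane_turn mulmxBl -!mulmxA u_proj w_proj. Qed.
Lemma proj_turn : plane_proj *m plane_turn = plane_turn.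
Proof. by rewrite {1}/plane_proj mulmxDl -!mulmxA u_turn w_turn mulmxN. Qed.
Lemma turn_turn : plane_turn *m plane_turn = - plane_proj.
Proof.
by rewrite {1}/plane_turn mulmxBl -!mulmxA u_turn w_turn mulmxN -opprD.
Qed.

Lemma plane_rotationD s t :
  plane_rotation (s + t) = plane_rotation s *m plane_rotation t.
Proof.
rewrite /plane_rotation cosD sinD !mulmxDl !mulmxDr -!scalemxAl -!scalemxAr.
rewrite !mulmx1 !mul1mx proj_proj turn_proj proj_turn turn_turn.
move: 1%:M plane_proj plane_turn => I P J.
by apply/matrixP => i j; rewrite !mxE; ring.
Qed.

Lemma plane_rotation0 : plane_rotation 0 = 1%:M.
Proof. by rewrite /plane_rotation cos0 sin0 subrr !scale0r !addr0. Qed.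

Lemma plane_rotationT t : (plane_rotation t)^T = plane_rotation (- t).
Proof.
rewrite /plane_rotation cosN sinN.
apply/matrixP => i j; rewrite !mxE [_ == j]eq_sym; congr (_ + _ * _ + _).
  by rewrite !big_ord1 !mxE; ring.
by rewrite !big_ord1 !mxE; ring.
Qed.

(** The determinant is 1 because a rotation is the square of the rotation by half
    its angle. *)
Lemma plane_rotation_uniform : uniform_rotation plane_rotation.
Proof.
have orth t : plane_rotation t *m (plane_rotation t)^T = 1%:M.
  by rewrite plane_rotationT -plane_rotationD subrr plane_rotation0.
split; [|exact: plane_rotationD|].
  move=> t; split; first exact: orth.
  have -> : t = t / 2 + t / 2 by field.
  rewrite plane_rotationD det_mulmx.
  by have := congr1 determinant (orth (t / 2)); rewrite det_mulmx det_tr det1.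
move=> t; apply: cvgD; last by apply: cvgZr_tmp; exact: continuous_sin.
apply: cvgD; first exact: cvg_cst.
by apply: cvgZr_tmp; apply: cvgB; [exact: continuous_cos|exact: cvg_cst].
Qed.

Lemma circle_rotation r s t :
  circle u w r (s + t) = circle u w r s *m plane_rotation t.
Proof.
rewrite /circle /plane_rotation !mulmxDr !mulmxDl -!scalemxAl -!scalemxAr.
rewrite !mulmx1 u_proj w_proj u_turn w_turn cosD sinD.
by apply/rowP => i; rewrite !mxE; ring.
Qed.
End Rotation.

Section Equilibrium.
Variables (R : realType) (d : nat) (u w : 'rV[R]_d) (r alpha : R) (N : nat).
Hypotheses (uu : dotv u u = 1) (ww : dotv w w = 1) (uw : dotv u w = 0).
Hypotheses (r0 : 0 < r) (alpha0 : 0 < alpha).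
Let n := N.+1.
Hypothesis n2 : (2 <= n)%N.
Hypothesis balance : alpha / 2 * ngon_potential r n alpha = r ^+ 2.
Local Notation X := (circle u w r).
Local Notation Y := (dcircle u w r).
Let T := tau R n.

Lemma n_tau : n%:R * T = 2 * pi.
Proof. by rewrite /T /tau; field; rewrite pnatr_eq0. Qed.

Lemma circle_modn (t : R) m : X (t + (m %% n)%:R * T) = X (t + m%:R * T).
Proof.
rewrite [in RHS](divn_eq m n) natrD mulrDl natrM -mulrA n_tau.
rewrite [_ * (2 * pi) + _]addrC addrA [(m %/ n)%:R * _]mulr_natl.
by rewrite (periodicn (circle_periodic u w r)).
Qed.

Lemma circleD (t s : R) : X (t + s) = cos s *: X t + sin s *: Y t.
Proof. by apply/rowP => i; rewrite !mxE cosD sinD; ring. Qed.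

Let g h := alpha / (2 * r * sin (h%:R * (pi / n%:R))) `^ (alpha + 2).

(** The tangential parts of the attractions of the bodies at h and n - h steps
    cancel. The radial parts add up, by [balance], to the centripetal
    acceleration at angular velocity 1. *)
Lemma circle_attraction (t : R) (i : 'I_n) :
  attraction alpha (fun j : 'I_n => X (t + (j : nat)%:R * T)) i =
  - X (t + (i : nat)%:R * T).
Proof.
set t' := t + (i : nat)%:R * T.
have half h : (h%:R * T) / 2 = h%:R * (pi / n%:R) by exact: half_angle.
have sin_gt0 h : (0 < h < n)%N -> 0 < sin (h%:R * (pi / n%:R)) :> R.
  exact: sin_half_angle_gt0.
(* the other bodies are renumbered by their distance h to body i, using the
   group structure of 'I_n and the periodicity of the circle *)
transitivity (\sum_(1 <= h < n) (- g h) *: (X t' - X (t' + h%:R * T))).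
  rewrite /attraction (reindex_inj (addrI i))/=.
  rewrite (eq_bigl (fun h => h != ord0)) => [|h]; last first.
    by rewrite -subr_eq0 addrAC subrr add0r.
  rewrite big_mkcond big_ord_recl/= add0r big_add1 big_mkord.
  apply: eq_bigr => h _; rewrite circle_modn natrD mulrDl addrA -/t'.
  have hn : (0 < lift ord0 h < n)%N by rewrite lift0/= ltnS ltn_ord.
  by rewrite circle_chord// lift0.
have symm : \sum_(1 <= h < n) g h * sin (h%:R * T) = 0.
  set S := \sum_(_ <= _ < _) _.
  suff : S = - S by move=> e; lra.
  rewrite {1}/S big_nat_rev -sumrN; apply: eq_big_nat => h /andP[h1 hn].
  have -> : (1 + n - h.+1 = n - h)%N by lia.
  have e1 : (n - h)%:R * (pi / n%:R) = pi - h%:R * (pi / n%:R) :> R.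
    by rewrite natrB ?(ltnW hn)//; field; rewrite pnatr_eq0.
  have e2 : (n - h)%:R * T = 2 * pi - h%:R * T.
    by rewrite natrB ?(ltnW hn)// mulrBl n_tau.
  rewrite /g e1 e2 [2 * pi]mulr_natl [pi *+ 2 - _]addrC sinD2pi sinN.
  by rewrite [pi - _]addrC sinDpi sinN opprK mulrN.
have kk : \sum_(1 <= h < n) g h * (1 - cos (h%:R * T)) = 1.
  have r20 : r ^+ 2 != 0 by rewrite gt_eqF// exprn_gt0.
  rewrite -[RHS](divff r20) -{1}balance /ngon_potential mulrAC mulr_sumr.
  apply: eq_big_nat => h hn; have s0 := sin_gt0 _ hn.
  have e0 : 0 < 2 * r * sin (h%:R * (pi / n%:R)) by rewrite !mulr_gt0.
  rewrite cos_1B2sin2 half /g powRD; last by rewrite (gt_eqF e0) implybT.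
  rewrite (powR_mulrn 2 (ltW e0)).
  have p0 := powR_gt0 alpha e0.
  by field; rewrite !gt_eqF.
transitivity (- (\sum_(1 <= h < n) g h * (1 - cos (h%:R * T))) *: X t' +
   (\sum_(1 <= h < n) g h * sin (h%:R * T)) *: Y t').
  rewrite -sumrN !scaler_suml -big_split/=; apply: eq_bigr => h _.
  by rewrite circleD; apply/rowP => j; rewrite !mxE; ring.
by rewrite symm kk scale0r addr0 scaleN1r.
Qed.

Lemma ngon_injective : injective (fun j : 'I_n => X ((j : nat)%:R * T)).
Proof.
move=> i j /eqP; rewrite -subr_eq0 => /eqP e.
have := circle_diff uu ww uw r0 ((i : nat)%:R * T) ((j : nat)%:R * T).
rewrite e /enorm /dotv big1 => [|k _]; last by rewrite mxE mul0r.
rewrite sqrtr0 => /esym/eqP; rewrite mulf_eq0 (gt_eqF (mulr_gt0 _ r0))//= normr_eq0.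
wlog ij : i j {e} / (i <= j)%N.
  move=> H; have [/H//|/ltnW/H{}H e'] := leqP i j.
  apply/esym/H; rewrite -[_ - _]opprB mulNr sinN oppr_eq0//.
move: ij; rewrite leq_eqVlt => /predU1P[/ord_inj//|ij].
rewrite -[_ - _]opprB -mulrBl -natrB ?(ltnW ij)// mulNr sinN oppr_eq0 half_angle gt_eqF//.
by apply: sin_half_angle_gt0; have := ltn_ord j; lia.
Qed.

Lemma ngon_centered : \sum_(j < n) X ((j : nat)%:R * T) = 0.
Proof.
have n0 : 0 < n%:R :> R by rewrite ltr0n.
have pi0 := pi_gt0 R.
have [||| C S] := @trig_sum0 R n T.
- by rewrite n_tau -(mul1r (2 * pi)) -[1]/(1%:R) cos_full_turns.
- by rewrite n_tau -(mul1r (2 * pi)) -[1]/(1%:R) sin_full_turns.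
- apply: cos_freq_neq1; rewrite /T /tau ger0_norm ?divr_ge0 ?mulr_ge0 ?ltW//.
  rewrite divr_gt0 ?mulr_gt0//= ltr_pdivrMr// ltr_pMr ?mulr_gt0//.
  by rewrite ltr1n.
rewrite /circle big_split/= -!scaler_suml -!mulr_sumr C S !mulr0 !scale0r addr0//.
Qed.

Lemma circle_newton : newton_solution alpha (choreography n X).
Proof.
move=> i t; rewrite /choreography.
set s := i%:R * tau R n.
have d1 (z : R) k : is_derive z 1 (fun y => X (y + s) ord0 k) (Y (z + s) ord0 k).
  exact: (@is_derive_shiftr _ (fun y => X y ord0 k) _ _ _
    (is_derive_circle_coord u w r k _)).
have d2 (z : R) k : is_derive z 1 (fun y => Y (y + s) ord0 k) (- X (z + s) ord0 k).
  exact: (@is_derive_shiftr _ (fun y => Y y ord0 k) _ _ _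
    (is_derive_dcircle_coord u w r k _)).
have D1 (z : R) : derivable (fun y : R => X (y + s)) z 1.
  by apply/derivable_mxP => a k; rewrite ord1; have ? := d1 z k; exact: ex_derive.
have E1 : derive1 (fun y : R => X (y + s)) = fun y => Y (y + s).
  apply/funext => y; rewrite derive1E derive_mx//; apply/rowP => k; rewrite mxE.
  by have ? := d1 y k; rewrite derive_val.
have D2 (z : R) : derivable (fun y : R => Y (y + s)) z 1.
  by apply/derivable_mxP => a k; rewrite ord1; have ? := d2 z k; exact: ex_derive.
split; [exact: D1|by rewrite E1|].
rewrite circle_attraction /derive1n/= E1 derive1E derive_mx//.
by apply/rowP => k; rewrite mxE; have ? := d2 t k; rewrite derive_val [RHS]mxE.
Qed.

Lemma circle_relative_equilibrium :
  relative_equilibrium alpha (fun j : 'I_n => X ((j : nat)%:R * T)) (choreography n X).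
Proof.
split; last exact: circle_newton.
- split; [exact: ngon_injective|exact: ngon_centered|exists 1 => // i].
  have := circle_attraction 0 i; rewrite add0r scale1r => <-.
  by congr attraction; apply/funext => j; rewrite add0r.
- exists (plane_rotation u w); first exact: plane_rotation_uniform.
  by move=> i t; rewrite -circle_rotation// addrC.
Qed.

Lemma ngon_regular : regular_ngon (fun j : 'I_n => X ((j : nat)%:R * T)).
Proof. by exists 0, u, w, r; split => // i; rewrite add0r. Qed.
End Equilibrium.

(** * Lower bound for the action *)

Section LowerBound.
Variable R : realType.
Notation mu := (@lebesgue_measure R).

(** By [weak_cauchy_schwarz], [chord_le] applies with [e t] the integral of v^2
    over [0, t]. *)
Lemma weak_chord n h (x v : R -> R) : continuous x -> periodic x (2 * pi) ->
  L2loc v -> (forall phi : R -> R, test_function phi ->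
    \int[mu]_(t in [set: R]) (x t * derive1 phi t) =
    - \int[mu]_(t in [set: R]) (v t * phi t)) -> (0 < h < n)%N ->
  \int[mu]_(t in `[0, 2 * pi]) ((x (t + h%:R * tau R n) - x t) ^+ 2) <=
  4 * sin (h%:R * (pi / n%:R)) ^+ 2 * \int[mu]_(t in `[0, 2 * pi]) (v t ^+ 2).
Proof.
move=> cx xT Lv xv hn.
pose e t := \int[mu]_(s in `[0, t]) (v s ^+ 2).
have ediff a b : 0 <= a -> a <= b -> e b - e a = \int[mu]_(t in `[a, b]) (v t ^+ 2).
  by move=> a0 ab; apply: Rintegral_itv_cat => //; exact: L2loc_integrable_sq.
have e_nd (a b : R) : 0 <= a -> a <= b -> b <= 2 * pi -> e a <= e b.
  move=> a0 ab _; rewrite -subr_ge0 ediff//.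
  by apply: Rintegral_ge0 => t _; exact: sqr_ge0.
have xe (a b : R) : 0 <= a -> a <= b -> b <= 2 * pi ->
    (x b - x a) ^+ 2 <= (b - a) * (e b - e a).
  by move=> a0 ab _; rewrite ediff//; exact: weak_cauchy_schwarz.
have := chord_le xT e_nd xe cx hn.
by rewrite {2}/e set_itv1 Rintegral_set1 subr0.
Qed.

(** The tangent at q0 of the convex function q^(-p), written exp (- p ln q); the
    inequality combines 1 + y <= exp y with ln z <= z - 1 at z = q / q0. *)
Lemma expR_ln_tangent (q q0 p : R) : 0 < q -> 0 < q0 -> 0 < p ->
  expR (- p * ln q0) * (1 + p) - p * expR (- p * ln q0) / q0 * q <= expR (- p * ln q).
Proof.
move=> q_gt0 q0_gt0 p0; set P := expR (- p * ln q0).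
have z0 : 0 < q / q0 by rewrite divr_gt0.
have -> : expR (- p * ln q) = P * expR (- p * ln (q / q0)).
  by rewrite /P -expRD ln_div//; congr expR; ring.
rewrite (_ : _ - _ = P * (1 - p * (q / q0 - 1))); last by ring.
rewrite ler_wpM2l ?expR_ge0//; apply: le_trans (expR_ge1Dx _).
have : ln (q / q0) <= q / q0 - 1.
  have := @le_ln1Dx R (q / q0 - 1); rewrite [1 + _]addrC subrK; apply; lra.
move=> h; rewrite mulNr lerD2l lerN2 ler_wpM2l// ltW//.
Qed.

Lemma sqrt_powRV (q alpha : R) : 0 < q ->
  ((Num.sqrt q) `^ alpha)^-1 = expR (- (alpha / 2) * ln q).
Proof.
move=> q0; rewrite -powR12_sqrt ?(ltW q0)// -powRrM -powRN /powR gt_eqF//.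
by rewrite [2^-1 * alpha]mulrC.
Qed.

Variables (d n : nat) (alpha r : R).
Hypotheses (alpha0 : 0 < alpha) (r0 : 0 < r).
Hypothesis balance : alpha / 2 * ngon_potential r n alpha = r ^+ 2.

(** Each potential term is bounded below by its tangent at the value it takes on
    the circle, and the mean square chord by [weak_chord]. The outcome is affine
    in the kinetic term K, whose coefficient vanishes by [balance]. *)
Lemma action_lower_bound (x : R -> 'rV[R]_d) : Lambda n x ->
  ((pi * r ^+ 2 + pi * ngon_potential r n alpha)%:E <= action n alpha x)%E.
Proof.
move=> [xH xnc]; have [cx xT _ _] := xH.
have wd := weak_deriv_spec xH; set v := weak_deriv x in wd *.
have pi0 := pi_gt0 R.
have cxi i : continuous (fun t => x t ord0 i).
  move=> t; apply: (@continuous_comp _ _ _ x (fun y : 'rV[R]_d => y ord0 i)).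
    exact: cx.
  exact: coord_continuous.
have xTi i : periodic (fun t => x t ord0 i) (2 * pi) by move=> t; rewrite xT.
pose Ki i := \int[mu]_(t in `[0, 2 * pi]) (v t ord0 i ^+ 2).
pose K := \sum_i Ki i.
have [iv Kv] := Rintegral_bigsum (index_enum 'I_d)
  (fun i => L2loc_integrable_sq 0 (2 * pi) (wd i).1).
have kinetic : (\int[mu]_(t in `[0%R, (2 * pi)%R]) ((enorm (v t)) ^+ 2)%:E = K%:E)%E.
  rewrite /K /Ki -Kv -EFin_Rintegral//; apply: eq_integral => t _.
  by rewrite enorm_sum_sq.
pose s h := h%:R * tau R n.
pose q h t := \sum_(i < d) (x (t + s h) ord0 i - x t ord0 i) ^+ 2.
have enq h t : enorm (x t - x (t + s h)) = Num.sqrt (q h t).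
  by congr Num.sqrt; apply: eq_bigr => i _; rewrite !mxE; ring.
have cqi h i : continuous (fun t => (x (t + s h) ord0 i - x t ord0 i) ^+ 2).
  have cd : continuous (fun t => x (t + s h) ord0 i - x t ord0 i).
    move=> t; apply: cvgB; last exact: cxi.
    exact: (@continuous_shiftr R (fun t => x t ord0 i) (s h) (cxi i) t).
  by move=> t; exact: (continuousM (@cd t) (@cd t)).
have cq h : continuous (q h).
  by move=> t; apply: cvg_big => [|i _]; [exact: add_continuous|exact: cqi].
have q_gt0 h t : (0 < h < n)%N -> 0 < q h t.
  move=> hn; rewrite /q -sqrtr_gt0 -enq enorm_gt0// subr_eq0; apply/eqP.
  by apply: xnc; lia.
pose S h := sin (h%:R * (pi / n%:R)) : R.
have qle h : (0 < h < n)%N ->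
    \int[mu]_(t in `[0, 2 * pi]) q h t <= 4 * S h ^+ 2 * K.
  move=> hn; have [_ ->] := Rintegral_bigsum (index_enum 'I_d)
    (fun i => integrable_itv_continuous 0 (2 * pi) (cqi h i)).
  rewrite mulr_sumr; apply: ler_sum => i _.
  by have [L W] := wd i; exact: weak_chord.
pose p := alpha / 2.
have p0 : 0 < p by rewrite divr_gt0.
pose g h t := expR (- p * ln (q h t)).
have cg h : (0 < h < n)%N -> continuous (g h).
  move=> hn t; apply: (@continuous_comp _ _ _ (fun t => - p * ln (q h t)) expR).
    apply: cvgMl_tmp; apply: (@continuous_comp _ _ _ (q h) (@ln R)); first exact: cq.
    by apply: continuous_ln; exact: q_gt0.
  exact: continuous_expR.
pose q0 h := (2 * r * S h) ^+ 2.
pose P h := expR (- p * ln (q0 h)).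
have S0 h : (0 < h < n)%N -> 0 < S h by exact: sin_half_angle_gt0.
have gle h : (0 < h < n)%N ->
    2 * pi * P h * (1 + p) - p * P h / r ^+ 2 * K <= \int[mu]_(t in `[0, 2 * pi]) g h t.
  move=> hn; have Sh := S0 h hn.
  have q00 : 0 < q0 h by rewrite exprn_gt0// !mulr_gt0.
  have iq : mu.-integrable `[0, 2 * pi] (EFin \o q h) by exact: integrable_itv_continuous.
  pose B := p * P h / q0 h.
  have B0 : 0 <= B by rewrite divr_ge0 ?mulr_ge0 ?expR_ge0 ?ltW.
  have icst k : mu.-integrable `[0, 2 * pi] (EFin \o (fun=> k : R)).
    exact: integrable_itv_continuous (@cst_continuous _ _ k).
  have iBq : mu.-integrable `[0, 2 * pi] (EFin \o (fun t => B * q h t)).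
    by apply: integrable_itv_continuous => t; apply: cvgMl_tmp; exact: cq.
  have : \int[mu]_(t in `[0, 2 * pi]) (P h * (1 + p) - B * q h t) <=
      \int[mu]_(t in `[0, 2 * pi]) g h t.
    apply: le_Rintegral => //.
      apply: integrable_itv_continuous => t; apply: cvgB; first exact: cvg_cst.
      by apply: cvgMl_tmp; exact: cq.
      by apply: integrable_itv_continuous; exact: cg.
    by move=> t _; exact: expR_ln_tangent (q_gt0 h t hn) q00 p0.
  rewrite RintegralB// Rintegral_cst_itv ?mulr_ge0 ?(ltW pi0)// subr0 RintegralZl//.
  apply: le_trans; have := ler_wpM2l B0 (qle h hn).
  rewrite (_ : B * (4 * S h ^+ 2 * K) = p * P h / r ^+ 2 * K); first by lra.
  by rewrite /B /q0; field; rewrite !gt_eqF.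
have Ppot : \sum_(1 <= h < n) P h = ngon_potential r n alpha.
  apply: eq_big_nat => h hn; have Sh := S0 h hn.
  have e0 : 0 < 2 * r * S h by rewrite !mulr_gt0.
  by rewrite /P -sqrt_powRV ?exprn_gt0// sqrtr_sqr gtr0_norm.
rewrite /action kinetic.
rewrite (eq_big_nat _ _
  (F2 := fun h => (\int[mu]_(t in `[0, 2 * pi]) g h t)%:E)); last first.
  move=> h hn; rewrite -EFin_Rintegral//; last first.
    by apply: integrable_itv_continuous; exact: cg.
  by apply: eq_integral => t _; rewrite enq sqrt_powRV ?q_gt0.
rewrite sumEFin -!EFinM -EFinD lee_fin.
have : \sum_(1 <= h < n) (2 * pi * P h * (1 + p) - p * P h / r ^+ 2 * K) <=
    \sum_(1 <= h < n) \int[mu]_(t in `[0, 2 * pi]) g h t.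
  by rewrite !big_nat; apply: ler_sum => h hn; exact: gle.
have -> : \sum_(1 <= h < n) (2 * pi * P h * (1 + p) - p * P h / r ^+ 2 * K) =
    2 * pi * (1 + p) * ngon_potential r n alpha -
    p * ngon_potential r n alpha / r ^+ 2 * K.
  rewrite sumrB -Ppot; congr (_ - _).
    by rewrite mulr_sumr; apply: eq_bigr => h _; ring.
  by rewrite -!mulr_suml -mulr_sumr.
rewrite /p balance divff ?gt_eqF ?exprn_gt0// mul1r => h1.
have : pi * r ^+ 2 = pi * (alpha / 2 * ngon_potential r n alpha) by rewrite balance.
lra.
Qed.
End LowerBound.

Section Radius.
Variables (R : realType) (n : nat) (alpha : R).

(** The potential is homogeneous of degree - alpha in r, so the equation reads
    r^(alpha + 2) = C with C > 0. *)
Lemma balanced_radius : (2 <= n)%N -> 0 < alpha ->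
  exists2 r : R, 0 < r & alpha / 2 * ngon_potential r n alpha = r ^+ 2.
Proof.
move=> n2 alpha0; pose C : R := alpha / 2 * ngon_potential 1 n alpha.
have S0 h : (0 < h < n)%N -> 0 < sin (h%:R * (pi / n%:R)) :> R.
  exact: sin_half_angle_gt0.
have C0 : 0 < C.
  rewrite mulr_gt0 ?divr_gt0// /ngon_potential.
  rewrite big_ltn// ltr_pwDl//; first by rewrite invr_gt0 powR_gt0// mulr1 mulr_gt0// S0.
  by rewrite big_nat sumr_ge0// => h _; rewrite invr_ge0 powR_ge0.
pose r := C `^ (alpha + 2)^-1; have r0 : 0 < r by exact: powR_gt0.
exists r => //.
have -> : ngon_potential r n alpha = (r `^ alpha)^-1 * ngon_potential 1 n alpha.
  rewrite /ngon_potential mulr_sumr; apply: eq_big_nat => h hn.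
  rewrite -invfM -powRM ?(ltW r0)//; last by rewrite mulr1 mulr_ge0// ltW// S0.
  by congr (_ `^ _)^-1; ring.
have rC : r `^ alpha * r ^+ 2 = C.
  rewrite -(powR_mulrn 2 (ltW r0)) -powRD; last by rewrite (gt_eqF r0) implybT.
  by rewrite /r -powRrM mulVf ?powRr1 ?(ltW C0)// gt_eqF// addr_gt0.
rewrite mulrCA -/C -rC mulKf// gt_eqF// powR_gt0//.
Qed.
End Radius.

(** * The minimizer *)

Unset Implicit Arguments.
Theorem theorem1 (R : realType) (n d : nat) (alpha : R)
    (hn : (2 <= n)%N) (hd : (2 <= d)%N) (halpha : 0 < alpha) :
  exists xbar : R -> 'rV[R]_d,
    [/\ Lambda n xbar,
        forall x : R -> 'rV[R]_d, Lambda n x ->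
          (action n alpha xbar <= action n alpha x)%E
      & exists2 c : 'I_n -> 'rV[R]_d, regular_ngon c
          & relative_equilibrium alpha c (choreography n xbar)].
Proof.
have [r r0 balance] := balanced_radius hn halpha.
pose i0 : 'I_d := Ordinal (ltnW hd); pose i1 : 'I_d := Ordinal hd.
have dotd (i j : 'I_d) : dotv (delta_mx ord0 i) (delta_mx ord0 j) = (i == j)%:R :> R.
  rewrite /dotv (bigD1 i)//= big1 => [|k ki]; last first.
    by rewrite !mxE/= (negbTE ki) mul0r.
  by rewrite !mxE !eqxx mul1r addr0.
pose u : 'rV[R]_d := delta_mx ord0 i0; pose w : 'rV[R]_d := delta_mx ord0 i1.
have uu : dotv u u = 1 by rewrite dotd eqxx.
have ww : dotv w w = 1 by rewrite dotd eqxx.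
have uw : dotv u w = 0 by rewrite dotd.
exists (circle u w r); split.
- exact: circle_Lambda.
- by move=> x Lx; rewrite circle_action//; exact: action_lower_bound.
- case: n hn balance => // N hn balance.
  exists (fun j : 'I_N.+1 => circle u w r ((j : nat)%:R * tau R N.+1)).
    exact: ngon_regular.
  exact: circle_relative_equilibrium.
Qed.
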